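(* Consider the sparse additive logistic model $Y\mid(\mathbf X=\mathbf x)\sim B(1,p(\mathbf x))$ with logit $g=\ln\frac{p}{1-p}\in\mathcal G_{\widetilde H}(d_0,\mathbf s)$, where $d_0\ln\left(\frac{de}{d_0}\right)\le n$. Then $$\inf_{\widetilde\eta}\ \sup_{\eta^*\in\mathcal C_{\widetilde H}(d_0,\mathbf s),\,\mathbb P_X}\mathcal E(\widetilde\eta,\eta^* )\ \ge\ \tilde C\sqrt{\frac{d_0\ln\left(\frac{de}{d_0}\right)}{n}+\sum_{j\in\mathcal J}n^{-\frac{2s_j}{2s_j+1}}}$$ for some constant $\tilde C>0$, where the infimum is taken over all classifiers $\widetilde\eta$ based on the data $(\mathbf X_1,Y_1),\dots,(\mathbf X_n,Y_n)$.
   Context: Model. $\mathbf X\in\mathbb R^d$ is a vector of linearly independent features with marginal distribution $\mathbb P_X$ supported on a bounded set $\mathcal X\subseteq[0,1]^d$; $Y\in\{0,1\}$ with $P(Y=1\mid\mathbf X=\mathbf x)=p(\mathbf x)$; the logit is $g(\mathbf x)=\ln\frac{p(\mathbf x)}{1-p(\mathbf x)}\in L_2(\mathcal X)$. The data $D=\{(\mathbf X_i,Y_i)\}_{i=1}^n$ are i.i.d. copies of $(\mathbf X,Y)$. For a classifier $\eta$, the (conditional) misclassification risk is $R(\eta)=P(Y\ne\eta(\mathbf X)\mid D)$. The Bayes classifier is $\eta^*(\mathbf x)=I\{p(\mathbf x)\ge1/2\}=I\{g(\mathbf x)\ge0\}$, and the misclassification excess risk of a data-based classifier $\widetilde\eta$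 is $\mathcal E(\widetilde\eta,\eta^* )=\mathbb E R(\widetilde\eta)-R(\eta^* )$, the expectation being over $D$. Function classes. Let $\psi_0=1$, $\psi_\ell(t)=\sqrt2\cos(\pi\ell t)$, $\ell\ge1$, and for a univariate $g_j$ on $[0,1]$ put $\beta_{j\ell}=\int_0^1g_j(t)\psi_\ell(t)\,dt$; because of the identifiability condition $\mathbb E g_j(X_j)=0$ the paper takes $\beta_{j0}=0$. The periodic Sobolev class is $\widetilde H^{s_j}[0,1]=\{g_j:\sum_{\ell\ge0}\ell^{2s_j}\beta_{j\ell}^2\le R_j\}$, $s_j>\frac12$, with fixed radius $R_j>0$. For $1\le d_0\le d$, $$\mathcal G_{\widetilde H}(d_0,\mathbf s)=\Big\{g\in L_2(\mathcal X):\ g(\mathbf x)=\mu+\sum_{j\in\mathcal J}g_j(x_j),\ \mathcal J\subseteq\{1,\dots,d\},\ |\mathcal J|\le d_0,\ g_j\in\widetilde H^{s_j}[0,1],\ \mathbb E g_j(X_j)=0,\ j\in\mathcal J\Big\},$$ where the active set $\mathcal J$ is unknown and ranges over all such subsets, and $\mathcal C_{\widetilde H}(d_0,\mathbf s)=\{\eta(\mathbf x)=I\{g(\mathbf x)\ge0\}:g\in\mathcal G_{\widetilde H}(d_0,\mathbf s)\}$. The supremum is over true logits $g\in\mathcal G_{\widetilde H}(d_0,\mathbf s)$ (with $\eta^*=I\{g\ge0\}$) and over marginal distributions $\mathbb P_X$. Indexing convention: $\mathbf s=(s_1,\dots,s_{d_0})$ lists the smoothness parameters of the (at most) $d_0$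 active components, the active features being enumerated by $1,\dots,d_0$ (some components may vanish); $\sum_{j\in\mathcal J}$ in the bound is the sum over these $d_0$ smoothness parameters. Constants. $\tilde C$ is a generic positive constant not depending on $n,d,d_0$.
   Formalization: Added: the sum of n^(-2s_j/(2s_j+1)) is at most an arbitrary fixed K (C may depend on K), and the radii R_j are bounded below; otherwise no C uniform in d_0 exists (d=d_0=n, s_j=s makes the bound exceed 1). s and R are fixed sequences. *)

(* Defs.v *)
From HB Require Import structures.
From mathcomp Require Import all_boot all_order all_algebra.
From mathcomp Require Import all_classical all_reals all_analysis.

Set Implicit Arguments.
Unset Strict Implicit.
Unset Printing Implicit Defensive.

Import Order.TTheory GRing.Theory Num.Theory.
Import numFieldNormedType.Exports.

Local Open Scope classical_set_scope.
Local Open Scope ring_scope.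

Section iid_law.
Context {d : measure_display} {T : measurableType d} {R : realType}.

Definition consT n (z : T * n.-tuple T) : n.+1.-tuple T := [tuple of z.1 :: z.2].

Lemma measurable_consT n : measurable_fun setT (@consT n).
Proof. exact: measurable_cons. Qed.

HB.instance Definition _ n := isMeasurableFun.Build _ _ _ _ (@consT n)
  (@measurable_consT n).

(* the n-fold product P (x) ... (x) P *)
Fixpoint iid_law (P : probability T R) n : probability (n.-tuple T) R :=
  match n with
  | 0%N => dirac [tuple]
  | m.+1 => distribution (P \x iid_law P m)%E (@consT m)
  end.

Lemma iid_lawE (P : probability T R) n (A : 'I_n -> set T) :
  (forall i, measurable (A i)) ->
  iid_law P n [set x | forall i, A i (tnth x i)] = (\prod_(i < n) P (A i))%E.
Proof.
elim: n A => [|n IH] A mA /=.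
  by rewrite big_ord0 diracE mem_set// => -[].
rewrite big_ord_recl /distribution /pushforward /=.
pose B : set (n.-tuple T) := [set x | forall i, A (lift ord0 i) (tnth x i)].
have mB : measurable B.
  rewrite (_ : B = \bigcap_(i in [set: 'I_n])
    ((fun x : n.-tuple T => tnth x i) @^-1` A (lift ord0 i))); last first.
    by apply/seteqP; split => [x Bx i _|x Bx i]; exact: Bx.
  apply: fin_bigcap_measurable; first exact: finite_finset.
  by move=> i _; rewrite -[X in measurable X]setTI; apply: measurable_tnth.
rewrite (_ : _ @^-1` _ = A ord0 `*` B); last first.
  apply/seteqP; split=> [[a x] /= Aax|[a x] /= [Aa Bx] i].
    split; first by have := Aax ord0; rewrite tnth0.
    by move=> i /=; have := Aax (lift ord0 i); rewrite tnthS.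
  by case: (unliftP ord0 i) => [j ->|->]; rewrite ?tnthS ?tnth0//; exact: Bx.
rewrite product_measure1E//; congr (_ * _)%E.
exact: (IH (fun i => A (lift ord0 i))).
Qed.

End iid_law.

Section periodic_sobolev.
Context {R : realType}.

Definition cos_basis (l : nat) (t : R) : R :=
  if l is 0%N then 1 else Num.sqrt 2 * cos (pi * l%:R * t).

Definition cos_coef (h : R -> R) (l : nat) : R :=
  \int[lebesgue_measure]_(t in `[0, 1]) (h t * cos_basis l t).

(* For s > 1/2 the elements of the class, which are defined almost everywhere
   only, have a continuous representative.  It is the one which is meant here,
   because the functions are evaluated at points whose law may be singular. *)
Definition periodic_sobolev (s rad : R) : set (R -> R) :=
  [set h : R -> R | [/\ {within `[0, 1], continuous h}, cos_coef h 0 = 0 &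
    (\sum_(0 <= l <oo) (l%:R `^ (2 * s) * cos_coef h l ^+ 2)%:E <= rad%:E)%E]].

End periodic_sobolev.

Section model.
Context {R : realType}.

Definition unit_cube {d} : set (d.-tuple R) :=
  [set x | forall j, tnth x j \in `[0, 1]].

Definition admissible_design d (PX : probability (d.-tuple R) R) : Prop :=
  PX unit_cube = 1%E /\
  forall a : 'I_d -> R,
    (\forall x \ae PX, \sum_(j < d) a j * tnth x j = 0) -> forall j, a j = 0.

(* The active features are enumerated by [e] with values in {0, .., d0 - 1};
   the component of feature j has smoothness s (e j) and radius rad (e j). *)
Definition sparse_additive d (d0 : nat) (s rad : nat -> R)
    (PX : probability (d.-tuple R) R) : set (d.-tuple R -> R) :=
  [set g | g \in Lfun PX 2%:E /\
    exists (mu : R) (J : {set 'I_d}) (e : 'I_d -> 'I_d0) (h : 'I_d -> R -> R),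
    [/\ (#|J| <= d0)%N, {in J &, injective e},
        forall j, j \in J -> periodic_sobolev (s (e j)) (rad (e j)) (h j),
        forall j, j \in J ->
          (\int[PX]_(x in unit_cube) (h j (tnth x j))%:E = 0)%E &
        forall x, unit_cube x -> g x = mu + \sum_(j in J) h j (tnth x j)]].

(* Q is the law of (X, Y) when X has law PX and Y | X = x ~ B(1, p x). *)
Definition bernoulli_response d (PX : probability (d.-tuple R) R)
    (p : d.-tuple R -> R) (Q : probability (d.-tuple R * bool)%type R) : Prop :=
  forall (A : set (d.-tuple R)) (B : set bool), measurable A ->
    (Q (A `*` B) = \int[PX]_(x in A) bernoulli_prob (p x) B)%E.

Definition logit d (p : d.-tuple R -> R) (x : d.-tuple R) : R :=
  ln (p x / (1 - p x)).

Definition sparse_logistic_model d (d0 : nat) (s rad : nat -> R)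
    (PX : probability (d.-tuple R) R) (p : d.-tuple R -> R)
    (Q : probability (d.-tuple R * bool)%type R) : Prop :=
  [/\ admissible_design PX,
      measurable_fun setT p /\ (forall x, 0 < p x < 1),
      sparse_additive d0 s rad PX (logit p) & bernoulli_response PX p Q].

Definition risk d (Q : probability (d.-tuple R * bool)%type R)
    (eta : d.-tuple R -> bool) : \bar R :=
  Q [set z | z.2 != eta z.1].

Definition bayes_classifier d (p : d.-tuple R -> R) (x : d.-tuple R) : bool :=
  1 / 2 <= p x.

Definition data_classifier d n :
    set (n.-tuple (d.-tuple R * bool) -> d.-tuple R -> bool) :=
  [set eta | measurable_fun setT
    (fun z : n.-tuple (d.-tuple R * bool) * d.-tuple R => eta z.1 z.2)].

Definition excess_risk d n (Q : probability (d.-tuple R * bool)%type R)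
    (eta : n.-tuple (d.-tuple R * bool) -> d.-tuple R -> bool)
    (etas : d.-tuple R -> bool) : \bar R :=
  (\int[iid_law Q n]_D risk Q (eta D) - risk Q etas)%E.

Definition max_excess_risk d n (d0 : nat) (s rad : nat -> R)
    (eta : n.-tuple (d.-tuple R * bool) -> d.-tuple R -> bool) : \bar R :=
  ereal_sup [set r | exists PX p Q, sparse_logistic_model d0 s rad PX p Q /\
    r = excess_risk Q eta (bayes_classifier p)].

Definition minimax_excess_risk (n d d0 : nat) (s rad : nat -> R) : \bar R :=
  ereal_inf (max_excess_risk d0 s rad @` @data_classifier d n).

End model.

(* Main.v *)
From HB Require Import structures.
Require Import Defs.
From mathcomp Require Import all_boot all_order all_algebra.
From mathcomp Require Import all_classical all_reals all_analysis.
From mathcomp Require Import measurable_realfun ring lra zify.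

(** The supremum over the model is bounded below by an average over a finite
    experiment.  The features take finitely many values x_a with weights w_a,
    and the logits are indexed by sign vectors th, one sign for each v in a
    finite set V, so that on the atoms that matter the logit is the
    superposition g_th(a) = sum_v th_v phi_v(a).  With m = 2 p - 1, which is
    g / 2 up to g^2 / 2, the excess risk of a classifier with values in
    {-1, 1} is half the mean of |m| - c m.  Hence, for signs drawn uniformly,
    the averaged excess risk of every data-based classifier is about
    (E|g| - E|E[g | D]|) / 4, and it is of the order of the typical size rho
    of the logit as soon as the posterior mean of the logit is much smaller
    than the logit itself:
    - E|g| is at least a multiple of rho, because the fourth moment of a
      Rademacher sum is controlled by its variance (avg_rademacher4);
    - if the phi_v are nearly orthogonal, the second moment of E[g | D] is at
      most sum_v b_v E|E[th_v | D]| with sum_v b_v = rho^2, and the posterior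
      mean of one sign is small, because flipping this sign changes the law of
      the n observations little in the Hellinger distance
      (hellinger_sum_prodw).
    This is finite_design_lower; design_lower transfers it to the minimax
    excess risk.

    Two experiments are needed, one for each term of the bound.

    Estimation (grid_lower).  All features are independent and uniform on the
    midpoints (k + 1/2) / (n + 1), where the cosines are exactly orthonormal,
    and the active components are t / sqrt n times signed sums of their N_j
    lowest cosines, so that rho^2 = t^2 sum_j N_j / n.  No single component
    carries the margin rho: the signs are hidden one by one, each at the scale
    1 / sqrt n, and the margins add up in squares.  The largest N_j that
    the Sobolev ball permits is about n^(1 / (2 s_j + 1)), since the condition
    is N_j^(2 s_j + 1) <= n.  Filling the low frequencies from 1 to N_j, and
    not a dyadic block, keeps the constants free of s_j.

    Selection (selection_lower).  Among the features, d0 groups of 2^k are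
    formed, each group being labelled by the binary words of length k, where
    2^k is about d / d0.  Choosing one feature in every group amounts to choosing
    d0 k signs, and the design lets the chosen features display these signs
    one at a time; so d0 k points are shattered with margin
    rho = t sqrt (d0 k / n).  Only the function cos (pi x) is used, whose
    Sobolev norm does not depend on the smoothness.

    As d0 / n is dominated by the estimation term, the first experiment also
    covers the case d < 2 d0. *)

Set Implicit Arguments.
Unset Strict Implicit.
Unset Printing Implicit Defensive.

Import Order.TTheory GRing.Theory Num.Theory.
Import numFieldNormedType.Exports.

Local Open Scope classical_set_scope.
Local Open Scope ring_scope.

(** * Uniform averages over sign vectors *)

Section rademacher.
Context {R : realType} {V : finType}.
Implicit Types (th : {ffun V -> bool}) (F G : {ffun V -> bool} -> R).

Definition sgb (b : bool) : R := if b then 1 else -1.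

Lemma sgbN b : sgb (~~ b) = - sgb b.
Proof. by case: b; rewrite /sgb ?opprK. Qed.

Lemma sgb_sqr b : sgb b ^+ 2 = 1.
Proof. by case: b; rewrite /sgb ?sqrrN expr1n. Qed.

Lemma normr_sgb b : `|sgb b| = 1.
Proof. by case: b; rewrite /sgb ?normrN normr1. Qed.

Definition avg F : R := (#|{ffun V -> bool}|%:R)^-1 * \sum_th F th.

Lemma avgD F G : avg (fun th => F th + G th) = avg F + avg G.
Proof. by rewrite /avg big_split mulrDr. Qed.

Lemma avgZ c F : avg (fun th => c * F th) = c * avg F.
Proof. by rewrite /avg -mulr_sumr mulrCA. Qed.

Lemma avgN F : avg (fun th => - F th) = - avg F.
Proof. by rewrite /avg sumrN mulrN. Qed.

Lemma avgB F G : avg (fun th => F th - G th) = avg F - avg G.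
Proof. by rewrite avgD avgN. Qed.

Lemma avg_sum (I : Type) (r : seq I) (P : pred I) (F : I -> {ffun V -> bool} -> R) :
  avg (fun th => \sum_(i <- r | P i) F i th) = \sum_(i <- r | P i) avg (F i).
Proof. by rewrite /avg exchange_big /= mulr_sumr. Qed.

Lemma eq_avg F G : F =1 G -> avg F = avg G.
Proof. by move=> FG; rewrite /avg (eq_bigr _ (fun th _ => FG th)). Qed.

Lemma ler_avg F G : (forall th, F th <= G th) -> avg F <= avg G.
Proof.
by move=> FG; rewrite /avg ler_wpM2l ?invr_ge0 ?ler0n// ler_sum.
Qed.

Lemma avg_const c : avg (fun=> c) = c.
Proof.
rewrite /avg sumr_const -[c *+ _]mulr_natl mulrA mulVf ?mul1r//.
by rewrite pnatr_eq0 -lt0n; apply/card_gt0P; exists [ffun=> true].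
Qed.

Lemma avg_ge0 F : (forall th, 0 <= F th) -> 0 <= avg F.
Proof. by move=> F0; rewrite -(avg_const 0) ler_avg. Qed.

Lemma avg_exists F c : c <= avg F -> exists th, c <= F th.
Proof.
move=> cF; apply/existsP; apply: contraLR cF => /existsPn Fc.
rewrite -ltNge -[ltRHS](avg_const c) /avg ltr_pM2l; last first.
  rewrite invr_gt0 ltr0n; apply/card_gt0P; by exists [ffun=> true].
apply: ltr_sum => [|th _]; last by rewrite ltNge Fc.
by apply/hasP; exists [ffun=> true]; rewrite ?mem_index_enum.
Qed.

Definition flip (v : V) th : {ffun V -> bool} :=
  [ffun u => if u == v then ~~ th u else th u].

Lemma flipK v : involutive (flip v).
Proof. by move=> th; apply/ffunP => u; rewrite !ffunE; case: eqP; rewrite ?negbK. Qed.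

Lemma flip_at v th : flip v th v = ~~ th v.
Proof. by rewrite ffunE eqxx. Qed.

Lemma flip_out v u th : u != v -> flip v th u = th u.
Proof. by rewrite ffunE => /negbTE ->. Qed.

Lemma avg_flip v F : avg (fun th => F (flip v th)) = avg F.
Proof.
by rewrite /avg [in RHS](reindex_inj (inv_inj (flipK v))).
Qed.

Lemma avg_odd v F : (forall th, F (flip v th) = - F th) -> avg F = 0.
Proof.
move=> Fodd; have := avg_flip v F; rewrite (eq_avg Fodd) avgN => h.
lra.
Qed.

Section rademacher_sum.
Variable c : V -> R.

Let Z (r : seq V) th := \sum_(v <- r) sgb (th v) * c v.

Let Z_flip v r th : v \notin r -> Z r (flip v th) = Z r th.
Proof.
move=> vr; apply: eq_big_seq => u ur; rewrite flip_out//.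
by apply: contraNneq vr => <-.
Qed.

Let avg_cross v r k : v \notin r -> avg (fun th => sgb (th v) * c v * Z r th ^+ k) = 0.
Proof.
by move=> vr; apply: (@avg_odd v) => th; rewrite Z_flip// flip_at sgbN !mulNr.
Qed.

Let avg_Z2 r : uniq r -> avg (fun th => Z r th ^+ 2) = \sum_(v <- r) c v ^+ 2.
Proof.
elim: r => [_|v r IH /= /andP[vr ur]].
  rewrite big_nil -[RHS](avg_const 0); apply: eq_avg => th.
  by rewrite /Z big_nil expr0n.
rewrite big_cons -(IH ur).
rewrite (eq_avg (G := fun th => (c v ^+ 2 + 2 * (sgb (th v) * c v * Z r th ^+ 1))
    + Z r th ^+ 2)).
  by rewrite !avgD avgZ avg_cross// avg_const mulr0 addr0.
move=> th; rewrite /Z big_cons -/(Z r th) sqrrD exprMn sgb_sqr expr1; ring.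
Qed.

Let avg_Z4 r : uniq r ->
  avg (fun th => Z r th ^+ 4) <= 3 * (\sum_(v <- r) c v ^+ 2) ^+ 2.
Proof.
elim: r => [_|v r IH /= /andP[vr ur]].
  rewrite big_nil expr0n mulr0 -[leRHS](avg_const 0) ler_avg// => th.
  by rewrite /Z big_nil expr0n.
rewrite big_cons.
rewrite (eq_avg (G := fun th => ((c v ^+ 4 + 4 * c v ^+ 2 * (sgb (th v) * c v * Z r th ^+ 1))
    + (6 * c v ^+ 2 * Z r th ^+ 2 + 4 * (sgb (th v) * c v * Z r th ^+ 3))) + Z r th ^+ 4)).
  rewrite !avgD !avgZ !avg_cross// avg_const avg_Z2//.
  have := IH ur; set s := \sum_(v <- r) _; set q := avg _ => hq.
  have : 0 <= c v ^+ 4 by rewrite (exprM _ 2 2) sqr_ge0.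
  rewrite (exprM _ 2 2) => h; rewrite sqrrD; nra.
move=> th; rewrite /Z big_cons -/(Z r th).
rewrite (_ : (sgb (th v) * c v + Z r th) ^+ 4 =
  (sgb (th v)^+2) ^+ 2 * c v ^+ 4 + 4 * sgb (th v) ^+ 2 * sgb (th v) * c v ^+ 3 * Z r th
  + 6 * sgb (th v) ^+ 2 * c v ^+ 2 * Z r th ^+ 2 + 4 * sgb (th v) * c v * Z r th ^+ 3
  + Z r th ^+ 4); last by ring.
rewrite sgb_sqr; ring.
Qed.

Lemma avg_rademacher2 :
  avg (fun th => (\sum_v sgb (th v) * c v) ^+ 2) = \sum_v c v ^+ 2.
Proof. exact/avg_Z2/index_enum_uniq. Qed.

(** The mixed terms of odd degree in a sign vanish when it is flipped, which
   leaves E (Z + c th)^4 = E Z^4 + 6 c^2 E Z^2 + c^4. *)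
Lemma avg_rademacher4 :
  avg (fun th => (\sum_v sgb (th v) * c v) ^+ 4) <= 3 * (\sum_v c v ^+ 2) ^+ 2.
Proof. exact/avg_Z4/index_enum_uniq. Qed.

End rademacher_sum.

End rademacher.

(** * The logistic link *)

Section sigmoid.
Context {R : realType}.
Implicit Types g : R.

Definition sigm g : R := (1 + expR (- g))^-1.

Lemma sigm_gt0 g : 0 < sigm g.
Proof. by rewrite invr_gt0 addr_gt0 ?expR_gt0. Qed.

Lemma sigmN g : sigm (- g) = 1 - sigm g.
Proof.
have h := expR_gt0 g; rewrite /sigm opprK expRN; field.
by rewrite !lt0r_neq0//; lra.
Qed.

Lemma sigm_lt1 g : sigm g < 1.
Proof. by have := sigm_gt0 (- g); rewrite sigmN; lra. Qed.

Lemma sigm_logit g : sigm g / (1 - sigm g) = expR g.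
Proof.
have h := expR_gt0 g; rewrite -sigmN /sigm opprK expRN; field.
by rewrite !lt0r_neq0//; lra.
Qed.

Lemma sigm_ge_half g : (1 / 2 <= sigm g) = (0 <= 2 * sigm g - 1).
Proof. by apply/idP/idP; lra. Qed.

Lemma sigm_lin_pos g : 0 <= g -> `|2 * sigm g - 1 - g / 2| <= g ^+ 2 / 2.
Proof.
move=> g0; have s1 := sigm_lt1 g; have s0 := sigm_gt0 g.
have : sigm g * (1 + expR (- g)) = 1 by rewrite mulVf// gt_eqF// addr_gt0 ?expR_gt0.
have : sigm g * expR (- g) = 1 - sigm g.
  rewrite -sigmN /sigm opprK expRN.
  have h := expR_gt0 g; field; by rewrite !lt0r_neq0//; lra.
move=> h1 h2.
have e1 : 1 - g <= expR (- g) by have := expR_ge1Dx (- g).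
have e2 : (1 + g) * expR (- g) <= 1.
  rewrite expRN ler_pdivrMr ?expR_gt0// mul1r; exact: expR_ge1Dx.
set s := sigm g in s0 s1 h1 h2 *; set e := expR (- g) in h1 h2 e1 e2 *.
have e0 : 0 < e by exact: expR_gt0.
rewrite ler_norml; apply/andP; split.
  have : (1 + g) * (1 - s) <= s by rewrite -h1; nra.
  nra.
have [g1|g1] := leP g 1; last by nra.
have : s * (1 - g) <= 1 - s by rewrite -h1; nra.
nra.
Qed.

(** The excess risk is governed by 2 p - 1, and this makes it linear in the
   logit, hence in the signs.  A quadratic remainder suffices, because the
   second moment of the logit is then rho^2, which is negligible before rho. *)
Lemma sigm_lin g : `|2 * sigm g - 1 - g / 2| <= g ^+ 2 / 2.
Proof.
have [/sigm_lin_pos//|g0] := leP 0 g.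
rewrite -normrN -[g ^+ 2]sqrrN; apply: le_trans (sigm_lin_pos _); last by rewrite oppr_ge0 ltW.
by rewrite sigmN le_eqVlt; apply/orP; left; apply/eqP; congr `| _ |; lra.
Qed.

(** Since sigm h / sigm g >= expR (- (g - h)) for h <= g, the Lipschitz constant
   does not depend on the size of the logits: the Hellinger distance between
   two laws of the label is controlled without any bound on p. *)
Lemma sqrt_sigm_lip g h : `|Num.sqrt (sigm g) - Num.sqrt (sigm h)| <= `|g - h| / 2.
Proof.
wlog gh : g h / h <= g.
  move=> H; have [/H//|/ltW/H] := leP h g.
  by rewrite distrC [in leRHS]distrC.
have e1 : 1 - (g - h) / 2 <= expR (- ((g - h) / 2)) by have := expR_ge1Dx (- ((g - h) / 2)).
have eh := expR_gt0 (- h); have eg := expR_gt0 (- g).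
have e2 : expR (- ((g - h) / 2)) ^+ 2 * sigm g <= sigm h.
  rewrite expr2 -expRD /sigm ler_pdivrMr ?addr_gt0// [leRHS]mulrC ler_pdivlMr ?addr_gt0//.
  rewrite mulrDr mulr1 -expRD.
  rewrite (_ : - ((g - h) / 2) + - ((g - h) / 2) = h - g); last by lra.
  rewrite (_ : h - g + - h = - g); last by lra.
  by rewrite lerD2r -[leRHS]expR0 ler_expR; lra.
have sg := sigm_gt0 g; have sh := sigm_gt0 h.
have mono : Num.sqrt (sigm h) <= Num.sqrt (sigm g).
  rewrite ler_sqrt ?(ltW sg)// /sigm lef_pV2 ?posrE ?addr_gt0// lerD2l ler_expR; lra.
have e3 : expR (- ((g - h) / 2)) * Num.sqrt (sigm g) <= Num.sqrt (sigm h).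
  rewrite -(ler_pXn2r (n := 2)) ?nnegrE ?mulr_ge0 ?sqrtr_ge0 ?expR_ge0//.
  by rewrite exprMn (sqr_sqrtr (ltW sg)) (sqr_sqrtr (ltW sh)).
have s1 : Num.sqrt (sigm g) <= 1.
  by rewrite -[leRHS]sqrtr1 ler_sqrt// ltW// sigm_lt1.
rewrite !ger0_norm ?subr_ge0//.
have := sqrtr_ge0 (sigm g).
nra.
Qed.

End sigmoid.

(** * Product weights and the Hellinger distance *)

Section product_weights.
Context {R : realType} {I : finType}.

Lemma big_tuple_cons (M : nmodType) n (G : n.+1.-tuple I -> M) :
  \sum_t G t = \sum_i \sum_(t : n.-tuple I) G [tuple of i :: t].
Proof.
rewrite pair_big /= (reindex (fun p : I * n.-tuple I => [tuple of p.1 :: p.2]))//=.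
exists (fun t => (thead t, [tuple of behead t])) => [[i t] _|t _] /=.
  by rewrite theadE; congr pair; apply: val_inj.
by rewrite -tuple_eta.
Qed.

Definition prodw n (q : I -> R) (t : n.-tuple I) : R := \prod_(i < n) q (tnth t i).

Lemma prodw_cons n (q : I -> R) i (t : n.-tuple I) :
  prodw q [tuple of i :: t] = q i * prodw q t.
Proof.
rewrite /prodw big_ord_recl tnth0; congr (_ * _).
by apply: eq_bigr => j _; rewrite tnthS.
Qed.

Lemma prodw_ge0 n (q : I -> R) (t : n.-tuple I) :
  (forall i, 0 <= q i) -> 0 <= prodw q t.
Proof. by move=> q0; exact: prodr_ge0. Qed.

Lemma sum_prodw n (q : I -> R) : \sum_(t : n.-tuple I) prodw q t = (\sum_i q i) ^+ n.
Proof.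
elim: n => [|n IH].
  rewrite (eq_bigr (fun=> 1)) => [|t _]; last by rewrite /prodw big_ord0.
  by rewrite sumr_const card_tuple expn0 expr0.
rewrite big_tuple_cons exprS mulr_suml; apply: eq_bigr => i _.
by rewrite -IH mulr_sumr; apply: eq_bigr => t _; rewrite prodw_cons.
Qed.

(** Le Cam's inequality.  Affinities multiply, so that the affinity of the
   products is rho ^+ n >= 1 - n (1 - rho), and P - P' is the product of
   sqrt P - sqrt P' and sqrt P + sqrt P', whose square has sum at most 4. *)
Lemma hellinger_sum_prodw n (q q' : I -> R) (h : R) : 0 < h ->
  (forall i, 0 <= q i) -> (forall i, 0 <= q' i) ->
  \sum_i q i = 1 -> \sum_i q' i = 1 ->
  n%:R * (\sum_i (Num.sqrt (q i) - Num.sqrt (q' i)) ^+ 2) <= h ^+ 2 ->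
  \sum_(t : n.-tuple I) `|prodw q t - prodw q' t| <= 2 * h.
Proof.
move=> h0 q0 q'0 q1 q'1 hell.
pose r i := Num.sqrt (q i); pose r' i := Num.sqrt (q' i).
have pr (f : I -> R) (t : n.-tuple I) : (forall i, 0 <= f i) ->
    prodw f t = prodw (fun i => Num.sqrt (f i)) t ^+ 2.
  move=> f0; rewrite /prodw -prodrXl; apply: eq_bigr => i _.
  by rewrite sqr_sqrtr.
pose rho := \sum_i r i * r' i.
have rho0 : 0 <= rho by apply: sumr_ge0 => i _; rewrite mulr_ge0 ?sqrtr_ge0.
have Erho : \sum_i (r i - r' i) ^+ 2 = 2 - 2 * rho.
  rewrite (eq_bigr (fun i => (q i + q' i) - 2 * (r i * r' i))) => [|i _].
    by rewrite sumrB big_split /= q1 q'1 -mulr_sumr.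
  by rewrite sqrrB !sqr_sqrtr//; ring.
have rho1 : rho <= 1.
  have : 0 <= \sum_i (r i - r' i) ^+ 2 by apply: sumr_ge0 => i _; exact: sqr_ge0.
  by rewrite Erho; lra.
have bern : 1 - n%:R * (1 - rho) <= rho ^+ n.
  elim: (n) => [|m IH]; first by rewrite mul0r subr0 expr0.
  have : rho * (1 - m%:R * (1 - rho)) <= rho ^+ m.+1 by rewrite exprS ler_wpM2l.
  apply: le_trans; rewrite -natr1.
  have : 0 <= m%:R * (1 - rho) ^+ 2 by rewrite mulr_ge0 ?sqr_ge0.
  by nra.
pose rP t := @prodw n r t; pose rP' t := @prodw n r' t.
have S0 : \sum_t rP t ^+ 2 = 1.
  rewrite -(expr1n _ n) -q1 -sum_prodw; apply: eq_bigr => t _; exact/esym/pr.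
have S1 : \sum_t rP' t ^+ 2 = 1.
  rewrite -(expr1n _ n) -q'1 -sum_prodw; apply: eq_bigr => t _; exact/esym/pr.
have S2 : \sum_t rP t * rP' t = rho ^+ n.
  rewrite -sum_prodw; apply: eq_bigr => t _; by rewrite /rP /rP' /prodw -big_split.
have Sm : \sum_t (rP t - rP' t) ^+ 2 <= h ^+ 2.
  apply: le_trans hell; rewrite -/r -/r' Erho.
  rewrite (eq_bigr (fun t => (rP t ^+ 2 + rP' t ^+ 2) - 2 * (rP t * rP' t))) => [|t _].
    by rewrite sumrB big_split /= S0 S1 -mulr_sumr S2; nra.
  by ring.
have Sp : \sum_t (rP t + rP' t) ^+ 2 <= 4.
  apply: (@le_trans _ _ (\sum_t (2 * rP t ^+ 2 + 2 * rP' t ^+ 2))).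
    apply: ler_sum => t _; have := sqr_ge0 (rP t - rP' t); nra.
  by rewrite big_split /= -!mulr_sumr S0 S1; lra.
apply: (@le_trans _ _ (\sum_t (h^-1 * (rP t - rP' t) ^+ 2 + h / 4 * (rP t + rP' t) ^+ 2))).
  apply: ler_sum => t _; rewrite (pr q)// (pr q')// -/(rP t) -/(rP' t).
  rewrite subr_sqr; set x := rP t - rP' t; set y := rP t + rP' t.
  have : 0 <= (h^-1 * `|x| - `|y| / 2) ^+ 2 by exact: sqr_ge0.
  rewrite normrM -(real_normK (num_real x)) -(real_normK (num_real y)).
  set X := `|x|; set Y := `|y| => H.
  have : 0 <= h * (h^-1 * X - Y / 2) ^+ 2 by rewrite mulr_ge0// ltW.
  rewrite (_ : h * _ = h^-1 * X ^+ 2 + h / 4 * Y ^+ 2 - X * Y); first by lra.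
  by field; rewrite gt_eqF.
rewrite big_split /= -!mulr_sumr.
have : h^-1 * (\sum_t (rP t - rP' t) ^+ 2) <= h.
  rewrite -[leRHS](mulKf (lt0r_neq0 h0)) -expr2.
  by rewrite ler_wpM2l// invr_ge0 ltW.
have : h / 4 * \sum_t (rP t + rP' t) ^+ 2 <= h / 4 * 4.
  by rewrite ler_wpM2l// divr_ge0// ltW.
lra.
Qed.

End product_weights.

(** * The averaged excess risk in a finite design *)

Section finite_design.
Context {R : realType} {A V : finType}.
Variables (n : nat) (w : A -> R) (gam : {ffun V -> bool} -> A -> R).

Definition label_weight th (z : A * bool) : R := w z.1 * sigm (sgb z.2 * gam th z.1).

(** The conditional mean of the label, coded in {-1, 1}. *)
Definition drift th a : R := 2 * sigm (gam th a) - 1.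

Hypotheses (w0 : forall a, 0 <= w a) (w1 : \sum_a w a = 1).

Lemma label_weight_ge0 th z : 0 <= label_weight th z.
Proof. by rewrite mulr_ge0// ltW// sigm_gt0. Qed.

Lemma sum_label_weight th : \sum_z label_weight th z = 1.
Proof.
rewrite -(pair_bigA _ (fun a b => label_weight th (a, b))) -w1.
apply: eq_bigr => a _; rewrite big_bool /label_weight /=.
by rewrite mul1r mulN1r sigmN; ring.
Qed.

Local Notation P th := (@prodw R _ n (label_weight th)).

Lemma sum_P th : \sum_t P th t = 1.
Proof. by rewrite sum_prodw sum_label_weight expr1n. Qed.

Lemma P_ge0 th t : 0 <= P th t.
Proof. exact/prodw_ge0/label_weight_ge0. Qed.

Lemma hellinger_label_weight th th' :
  \sum_z (Num.sqrt (label_weight th z) - Num.sqrt (label_weight th' z)) ^+ 2 <=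
  (\sum_a w a * (gam th a - gam th' a) ^+ 2) / 2.
Proof.
rewrite -(pair_bigA _ (fun a b =>
  (Num.sqrt (label_weight th (a, b)) - Num.sqrt (label_weight th' (a, b))) ^+ 2)).
rewrite mulr_suml; apply: ler_sum => a _; rewrite big_bool /label_weight /=.
rewrite !sqrtrM// -!mulrBr !exprMn sqr_sqrtr// !mul1r !mulN1r -mulrDr -mulrA.
apply: ler_wpM2l => //.
have lip (g h : R) : (Num.sqrt (sigm g) - Num.sqrt (sigm h)) ^+ 2 <= (g - h) ^+ 2 / 4.
  have := sqrt_sigm_lip g h.
  rewrite -(real_normK (num_real (g - h))) -(real_normK (num_real (_ - Num.sqrt (sigm h)))).
  have := normr_ge0 (Num.sqrt (sigm g) - Num.sqrt (sigm h)).
  by have := normr_ge0 (g - h); nra.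
have := lip (gam th a) (gam th' a); have := lip (- gam th a) (- gam th' a).
rewrite (_ : (- gam th a - - gam th' a) ^+ 2 = (gam th a - gam th' a) ^+ 2); first by lra.
by ring.
Qed.

(** Atoms outside main carry a logit that need not be linear in the signs; their
   contribution to the excess risk is nonnegative and is dropped.  The value of
   tau comes from finite_design_lower, where the posterior mean must stay below
   a quarter of the size of the logit. *)
Variables (phi : V -> A -> R) (main : pred A) (b : V -> R) (rho : R).
Let tau : R := 54 ^- 2.
Hypotheses (rho0 : 0 < rho) (rho1 : rho <= 1 / 72).
Hypothesis b0 : forall v, 0 <= b v.
Hypothesis b1 : \sum_v b v = rho ^+ 2.
Hypothesis gamE : forall th a, main a -> gam th a = \sum_v sgb (th v) * phi v a.
Hypothesis gram : forall u : V -> R,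
  \sum_(a | main a) w a * (\sum_v u v * phi v a) ^+ 2 <= \sum_v b v * u v ^+ 2.
Hypothesis S_hi : forall a, main a -> \sum_v phi v a ^+ 2 <= 2 * rho ^+ 2.
Hypothesis S_lo : rho ^+ 2 / 2 <= \sum_(a | main a) w a * \sum_v phi v a ^+ 2.
Hypothesis hell : forall v th, b v != 0 ->
  n%:R * (\sum_a w a * (gam th a - gam (flip v th) a) ^+ 2) <= 8 * tau ^+ 2.

(** The marginal law of the sample, and the posterior mean of one sign times
   this law. *)
Let pibar t : R := avg (fun th => P th t).
Let pi v t : R := avg (fun th => sgb (th v) * P th t).

Let pibar0 t : 0 <= pibar t.
Proof. by apply: avg_ge0 => th; exact: P_ge0. Qed.

Let sum_pibar : \sum_t pibar t = 1.
Proof. by rewrite -avg_sum (eq_avg sum_P) avg_const. Qed.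

Let norm_avg F : `|@avg R V F| <= avg (fun th => `|F th|).
Proof.
rewrite /avg normrM ger0_norm ?invr_ge0// ler_wpM2l ?invr_ge0//.
exact: ler_norm_sum.
Qed.

Let pi_le v t : `|pi v t| <= pibar t.
Proof.
apply: le_trans (norm_avg _) _; apply: ler_avg => th.
by rewrite normrM normr_sgb mul1r ger0_norm// P_ge0.
Qed.

(** Pairing th with flip v th turns the posterior mean of the sign v into half
   the averaged total variation between the two laws of the sample. *)
Let sum_pi v : b v != 0 -> \sum_t `|pi v t| <= 2 * tau.
Proof.
move=> bv.
have tau0 : 0 < tau by rewrite /tau invr_gt0 exprn_gt0.
have E t : pi v t = 2^-1 * avg (fun th => sgb (th v) * (P th t - P (flip v th) t)).
  rewrite (eq_avg (G := fun th => sgb (th v) * P th t + sgb (flip v th v) * P (flip v th) t)).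
    rewrite avgD (avg_flip v (fun th => sgb (th v) * P th t)) -/(pi v t); lra.
  by move=> th; rewrite flip_at sgbN; ring.
apply: (@le_trans _ _ (\sum_t 2^-1 * avg (fun th => `|P th t - P (flip v th) t|))).
  apply: ler_sum => t _; rewrite E normrM ger0_norm// ler_wpM2l//.
  by apply: le_trans (norm_avg _) _; apply: ler_avg => th; rewrite normrM normr_sgb mul1r.
rewrite -mulr_sumr -avg_sum.
suff : avg (fun th => \sum_t `|P th t - P (flip v th) t|) <= 4 * tau by lra.
rewrite -[leRHS](@avg_const _ V); apply: ler_avg => th.
rewrite (_ : 4 * tau = 2 * (2 * tau)); last by ring.
apply: hellinger_sum_prodw; rewrite ?sum_label_weight//; first by rewrite mulr_gt0.
- exact: label_weight_ge0.
- exact: label_weight_ge0.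
have := hell th bv; have := hellinger_label_weight th (flip v th).
set x := \sum_z _; set y := \sum_a _ => xy.
have : n%:R * x <= n%:R * (y / 2) by rewrite ler_wpM2l.
lra.
Qed.

Variable c : n.-tuple (A * bool) -> A -> bool.

(** The classifier is correlated with the logit through its posterior mean only.
   By Young's inequality this correlation is at most
   lam / 2 + (2 lam)^-1 E (E[g | D])^2, and gram bounds the square by
   sum_v b v (E[th_v | D])^2, where a square is at most the absolute value. *)
Let test_le : avg (fun th => \sum_t P th t *
  (\sum_(a | main a) w a * (sgb (c t a) * gam th a))) <= rho / 36.
Proof.
have E t : avg (fun th => P th t * (\sum_(a | main a) w a * (sgb (c t a) * gam th a))) =
    \sum_(a | main a) w a * (sgb (c t a) * \sum_v pi v t * phi v a).
  rewrite (eq_avg (G := fun th => \sum_(a | main a) \sum_v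
    (w a * sgb (c t a) * phi v a) * (sgb (th v) * P th t))).
    rewrite avg_sum; apply: eq_bigr => a _; rewrite avg_sum mulrA mulr_sumr.
    by apply: eq_bigr => v _; rewrite avgZ /pi; ring.
  move=> th; rewrite mulr_sumr; apply: eq_bigr => a ma.
  rewrite gamE// !mulr_sumr; apply: eq_bigr => v _; ring.
rewrite avg_sum; under eq_bigr do rewrite E.
pose lam := rho / 54.
have lam0 : 0 < lam by rewrite divr_gt0.
pose B t := pibar t * (lam / 2) + (2 * lam)^-1 * \sum_v b v * `|pi v t|.
have le_B t : \sum_(a | main a) w a * (sgb (c t a) * \sum_v pi v t * phi v a) <= B t.
  pose u v := pi v t / pibar t.
  have piE v : pi v t = pibar t * u v.
    rewrite /u; have [p0|p0] := eqVneq (pibar t) 0; last by rewrite mulrCA divff ?mulr1.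
    by rewrite p0 mul0r; apply/eqP; rewrite -normr_le0; have := pi_le v t; rewrite p0.
  have u_le1 v : `|u v| <= 1.
    rewrite /u normrM normfV (ger0_norm (pibar0 t)).
    have [p0|p0] := eqVneq (pibar t) 0; first by rewrite p0 invr0 mulr0.
    by rewrite ler_pdivrMr ?mul1r// lt_neqAle eq_sym p0 pibar0.
  apply: (@le_trans _ _ (pibar t * (lam / 2 + (2 * lam)^-1 *
      \sum_(a | main a) w a * (\sum_v u v * phi v a) ^+ 2))).
    rewrite (eq_bigr (fun a => pibar t * (w a * (sgb (c t a) * \sum_v u v * phi v a)))); last first.
      move=> a _; rewrite [RHS]mulrCA; congr (_ * _); rewrite [RHS]mulrCA; congr (_ * _).
      rewrite mulr_sumr; apply: eq_bigr => v _; by rewrite piE -mulrA.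
    rewrite -mulr_sumr ler_wpM2l//.
    apply: (@le_trans _ _ (\sum_(a | main a) w a * (lam / 2 + (2 * lam)^-1 *
        (\sum_v u v * phi v a) ^+ 2))).
      apply: ler_sum => a _; rewrite ler_wpM2l//; set x := \sum_v _.
      apply: (@le_trans _ _ `|x|).
        by rewrite -[leRHS]mul1r -(normr_sgb (c t a)) -normrM ler_norm.
      rewrite -(real_normK (num_real x)); set X := `|x|.
      have : 0 <= (2 * lam)^-1 * (X - lam) ^+ 2.
        by rewrite mulr_ge0 ?sqr_ge0 ?invr_ge0 ?mulr_ge0// ltW.
      rewrite (_ : _^-1 * _ = lam / 2 + (2 * lam)^-1 * X ^+ 2 - X); first by lra.
      by field; rewrite gt_eqF.
    rewrite (eq_bigr (fun a => w a * (lam / 2) + (2 * lam)^-1 *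
        (w a * (\sum_v u v * phi v a) ^+ 2))) => [|a _]; last by ring.
    rewrite big_split /= -mulr_sumr lerD2r -mulr_suml ler_piMl//; first by rewrite divr_ge0// ltW.
    rewrite -w1 [leRHS](bigID main) /= lerDl; exact: sumr_ge0.
  rewrite mulrDr lerD2l mulrCA ler_wpM2l//; first by rewrite invr_ge0 mulr_ge0// ltW.
  apply: le_trans (ler_wpM2l (pibar0 t) (gram u)) _.
  rewrite mulr_sumr; apply: ler_sum => v _; rewrite mulrCA ler_wpM2l//.
  rewrite piE normrM (ger0_norm (pibar0 t)) ler_wpM2l//.
  by rewrite -(real_normK (num_real (u v))) expr2 ler_piMl.
apply: le_trans (ler_sum _ (fun t _ => le_B t)) _.
rewrite big_split /= -mulr_suml sum_pibar mul1r -mulr_sumr exchange_big /=.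
have : \sum_v \sum_t b v * `|pi v t| <= 2 * tau * rho ^+ 2.
  rewrite -b1 mulr_sumr; apply: ler_sum => v _; rewrite -mulr_sumr mulrC.
  have [->|bv] := eqVneq (b v) 0; first by rewrite !mulr0.
  by rewrite ler_wpM2r// sum_pi.
set x := \sum_v _ => hx.
have : (2 * lam)^-1 * x <= (2 * lam)^-1 * (2 * tau * rho ^+ 2).
  by rewrite ler_wpM2l// invr_ge0 mulr_ge0// ltW.
rewrite (_ : _ * (2 * tau * _) = rho / 54); first by rewrite /lam; lra.
by rewrite /lam /tau; field; rewrite gt_eqF.
Qed.

Let avg_sqr_le : avg (fun th => \sum_(a | main a) w a * gam th a ^+ 2) <= rho ^+ 2.
Proof.
rewrite -[leRHS](@avg_const _ V); apply: ler_avg => th.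
rewrite (eq_bigr (fun a => w a * (\sum_v sgb (th v) * phi v a) ^+ 2)) => [|a ma].
  apply: le_trans (gram _) _; rewrite -b1.
  by apply: ler_sum => v _; rewrite sgb_sqr mulr1.
by rewrite gamE.
Qed.

Let avg_sqr a : main a -> avg (fun th => gam th a ^+ 2) = \sum_v phi v a ^+ 2.
Proof.
move=> ma; rewrite -avg_rademacher2; apply: eq_avg => th; by rewrite gamE.
Qed.

(** Integration of |x| >= x^2 / al - x^4 / (4 al^3) with al = 3 rho: the second
   moment is at least rho^2 / 2, and the fourth is at most 6 rho^2 times it. *)
Let avg_norm_ge :
  rho / 9 <= avg (fun th => \sum_(a | main a) w a * `|gam th a|).
Proof.
pose al := 3 * rho.
have al0 : 0 < al by rewrite mulr_gt0.
have low x : al^-1 * x ^+ 2 - (4 * al ^+ 3)^-1 * x ^+ 4 <= `|x|.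
  have <- : `|x| ^+ 2 = x ^+ 2 by exact/real_normK/num_real.
  have -> : x ^+ 4 = `|x| ^+ 4 by rewrite (exprM x 2 2) -(real_normK (num_real x)) -exprM.
  set X := `|x|; have X0 : 0 <= X by exact: normr_ge0.
  suff h : 0 <= X * (al - X + (4 * al ^+ 2)^-1 * X ^+ 3).
    have : 0 <= al^-1 * (X * (al - X + (4 * al ^+ 2)^-1 * X ^+ 3)).
      by rewrite mulr_ge0// invr_ge0 ltW.
    rewrite (_ : al^-1 * _ = X - al^-1 * X ^+ 2 + (4 * al ^+ 3)^-1 * X ^+ 4); first by lra.
    by field; rewrite gt_eqF.
  apply: mulr_ge0 => //.
  pose y := X / al; have y0 : 0 <= y by rewrite divr_ge0// ltW.
  have -> : X = al * y by rewrite /y mulrC divfK// gt_eqF.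
  rewrite (_ : _ + _ = al * (1 - y + y ^+ 3 / 4)); last by field; rewrite gt_eqF.
  apply: mulr_ge0; first exact: ltW.
  have : 0 <= (y - 1) ^+ 2 * (y + 2) by rewrite mulr_ge0 ?sqr_ge0//; lra.
  have : (y - 1) ^+ 2 * (y + 2) = y ^+ 3 - 3 * y + 2 by ring.
  by nra.
have pt a : main a -> al^-1 * (\sum_v phi v a ^+ 2) - (4 * al ^+ 3)^-1 *
    (6 * rho ^+ 2 * (\sum_v phi v a ^+ 2)) <= avg (fun th => `|gam th a|).
  move=> ma; apply: le_trans (ler_avg (fun th => low (gam th a))).
  rewrite avgB !avgZ avg_sqr// lerD2l lerN2 ler_wpM2l//; first by rewrite invr_ge0 mulr_ge0// exprn_ge0// ltW.
  rewrite (eq_avg (G := fun th => (\sum_v sgb (th v) * phi v a) ^+ 4)).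
    apply: le_trans (avg_rademacher4 _) _; set s := \sum_v _.
    have s0 : 0 <= s by apply: sumr_ge0 => v _; exact: sqr_ge0.
    have := S_hi ma; rewrite -/s; nra.
  by move=> th; rewrite gamE.
rewrite avg_sum.
apply: (@le_trans _ _ (\sum_(a | main a) (al^-1 - (4 * al ^+ 3)^-1 * (6 * rho ^+ 2)) *
    (w a * (\sum_v phi v a ^+ 2)))); last first.
  apply: ler_sum => a ma; rewrite avgZ mulrCA ler_wpM2l//.
  by apply: le_trans (pt _ ma); rewrite mulrBl !mulrA.
rewrite -mulr_sumr.
rewrite (_ : al^-1 - _ = 5 / 18 * rho^-1); last first.
  by rewrite /al; field; rewrite gt_eqF.
have : 5 / 18 * rho^-1 * (rho ^+ 2 / 2) <= 5 / 18 * rho^-1 *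
    \sum_(a | main a) w a * \sum_v phi v a ^+ 2.
  by rewrite ler_wpM2l// mulr_ge0 ?invr_ge0 ?(ltW rho0)//; lra.
apply: le_trans.
rewrite (_ : _ * (rho ^+ 2 / 2) = 5 / 36 * rho); first by have := rho0; lra.
by field; rewrite gt_eqF.
Qed.

(** On the main atoms the conditional excess risk is at least half of
   |g| / 2 - c g / 2 - g^2, whose averages are bounded by avg_norm_ge, test_le
   and avg_sqr_le: rho / 18 - rho / 72 - rho / 72, halved. *)
Lemma finite_design_lower : exists th, rho / 72 <=
  \sum_t P th t * \sum_a w a * ((`|drift th a| - sgb (c t a) * drift th a) / 2).
Proof.
apply: avg_exists.
pose F th := 2^-1 * (2^-1 * (\sum_(a | main a) w a * `|gam th a|)
  - 2^-1 * (\sum_t P th t * (\sum_(a | main a) w a * (sgb (c t a) * gam th a)))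
  - \sum_(a | main a) w a * gam th a ^+ 2).
apply: (@le_trans _ _ (avg F)).
  rewrite /F avgZ !avgB !avgZ.
  have rho2 : rho ^+ 2 <= rho / 72.
    by rewrite expr2 ler_wpM2l ?(ltW rho0)//; move: rho1; lra.
  move: test_le avg_norm_ge avg_sqr_le rho2.
  set x := avg _; set y := avg _; set z := avg _; lra.
apply: ler_avg => th; rewrite /F.
apply: (@le_trans _ _ (\sum_t P th t * (2^-1 * (2^-1 * (\sum_(a | main a) w a * `|gam th a|)
  - 2^-1 * (\sum_(a | main a) w a * (sgb (c t a) * gam th a))
  - \sum_(a | main a) w a * gam th a ^+ 2)))).
  rewrite le_eqVlt; apply/orP; left; apply/eqP.
  set x := \sum_(a | main a) _ * `|_|; set z := \sum_(a | main a) w a * _ ^+ 2.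
  rewrite [RHS](eq_bigr (fun t => P th t * (2^-1 * (2^-1 * x - z)) - 2^-1 * 2^-1 *
    (P th t * (\sum_(a | main a) w a * (sgb (c t a) * gam th a))))) => [|t _]; last by ring.
  by rewrite sumrB -mulr_suml sum_P -mulr_sumr; ring.
apply: ler_sum => t _; rewrite ler_wpM2l ?P_ge0//.
have dr a : 0 <= (`|drift th a| - sgb (c t a) * drift th a) / 2.
  rewrite divr_ge0// subr_ge0 -[leRHS]mul1r -(normr_sgb (c t a)) -normrM; exact: ler_norm.
rewrite [leRHS](bigID main) /= -[leLHS]addr0; apply: lerD; last first.
  by apply: sumr_ge0 => a _; rewrite mulr_ge0.
rewrite !mulr_sumr -!sumrB mulr_sumr; apply: ler_sum => a ma.
rewrite (_ : 2^-1 * _ = w a * (2^-1 * (2^-1 * `|gam th a| - 2^-1 * (sgb (c t a) * gam th a)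
  - gam th a ^+ 2))); last by ring.
rewrite ler_wpM2l// mulrC ler_wpM2r//.
have := sigm_lin (gam th a); rewrite -/(drift th a).
set g := gam th a; set m := drift th a; rewrite ler_norml => /andP[h1 h2].
have h3 : `|g| / 2 - g ^+ 2 / 2 <= `|m|.
  have [g0|g0] := leP 0 g.
    by rewrite (ger0_norm g0); have := ler_norm m; lra.
  by rewrite (ltr0_norm g0); have := ler_norm (- m); rewrite normrN; lra.
have h4 : sgb (c t a) * m <= sgb (c t a) * g / 2 + g ^+ 2 / 2.
  by rewrite /sgb; case: ifP => _; lra.
lra.
Qed.

End finite_design.

(** * Laws with finitely many atoms *)

Section discrete_law.
Context {d : measure_display} {T : measurableType d} {R : realType} {I : finType}.
Implicit Types S : set T.

(** Only measurable sets are tested, so that the property can be checked on the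
   sections that define a product measure. *)
Definition discrete_law (P : set T -> \bar R) (w : I -> R) (x : I -> T) : Prop :=
  forall S, measurable S -> P S = (\sum_i w i * \1_S (x i))%:E.

Section atoms.
Variables (w : I -> R) (x : I -> T) (w0 : forall i, 0 <= w i).

Fixpoint atoms_measure (s : seq I) : {measure set T -> \bar R} :=
  if s is i :: s' then
    measure_add (mscale (NngNum (w0 i)) (dirac (x i))) (atoms_measure s')
  else mzero.

Lemma atoms_measureE (s : seq I) S : atoms_measure s S = (\sum_(i <- s) w i * \1_S (x i))%:E.
Proof.
elim: s => [|i s IH]; first by rewrite big_nil.
by rewrite big_cons EFinD -IH [LHS]measure_addE.
Qed.

Lemma ge0_integral_atoms (s : seq I) (D : set T) (f : T -> \bar R) :
  measurable D -> measurable_fun D f -> (forall y, D y -> 0 <= f y)%E ->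
  (\int[atoms_measure s]_(y in D) f y = \sum_(i <- s) (w i * \1_D (x i))%:E * f (x i))%E.
Proof.
move=> mD mf f0; elim: s => [|i s IH].
  by rewrite big_nil integral_measure_zero.
rewrite big_cons -IH [LHS]ge0_integral_measure_add//; congr (_ + _)%E.
by rewrite ge0_integral_mscale// integral_dirac// muleA EFinM.
Qed.

Definition atoms_prob (w1 : \sum_i w i = 1) : set T -> \bar R :=
  atoms_measure (index_enum I).

HB.instance Definition _ w1 :=
  Measure.copy (atoms_prob w1) (Measure.sort (atoms_measure (index_enum I))).

Lemma atoms_prob_setT w1 : atoms_prob w1 setT = 1%E.
Proof.
rewrite /atoms_prob atoms_measureE.
by under eq_bigr do rewrite indicT mulr1; rewrite w1.
Qed.

HB.instance Definition _ w1 :=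
  Measure_isProbability.Build _ _ _ (atoms_prob w1) (atoms_prob_setT w1).

Lemma exists_discrete_law : \sum_i w i = 1 ->
  exists P : probability T R, discrete_law P w x.
Proof. by move=> w1; exists (atoms_prob w1) => S _; exact: atoms_measureE. Qed.

End atoms.

Variables (P : probability T R) (w : I -> R) (x : I -> T).
Hypotheses (w0 : forall i, 0 <= w i) (Pw : discrete_law P w x).

Lemma ge0_integral_discrete (D : set T) (f : T -> \bar R) :
  measurable D -> measurable_fun D f -> (forall y, D y -> 0 <= f y)%E ->
  (\int[P]_(y in D) f y = \sum_i (w i * \1_D (x i))%:E * f (x i))%E.
Proof.
move=> mD mf f0; rewrite -(ge0_integral_atoms x w0)//.
by apply: eq_measure_integral => S mS _; rewrite atoms_measureE; exact: Pw.
Qed.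

Lemma integral_discrete (D : set T) (f : T -> R) :
  measurable D -> measurable_fun D f ->
  (\int[P]_(y in D) (f y)%:E = (\sum_i w i * \1_D (x i) * f (x i))%:E)%E.
Proof.
move=> mD mf; rewrite integralE.
have mE : measurable_fun D (EFin \o f) by exact/measurable_EFinP.
rewrite !ge0_integral_discrete//; last 2 first.
- exact: measurable_funeneg.
- exact: measurable_funepos.
have E (G : T -> \bar R) (g : T -> R) : (forall y, G y = (g y)%:E) ->
    (\sum_i (w i * \1_D (x i))%:E * G (x i))%E =
    (\sum_i w i * \1_D (x i) * g (x i))%:E.
  by move=> Gg; rewrite -sumEFin; apply: eq_bigr => i _; rewrite Gg EFinM.
rewrite (E _ (fun y => Num.max (f y) 0)); last by move=> y; rewrite funeposE EFin_max.
rewrite (E _ (fun y => Num.max (- f y) 0)); last by move=> y; rewrite funenegE EFin_max.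
rewrite -EFinB -sumrB; congr EFin.
apply: eq_bigr => i _; rewrite -mulrBr; congr (_ * _).
have [h|h] := leP 0 (f (x i)).
  by rewrite (max_idPr _) ?subr0// oppr_le0.
by rewrite (max_idPl _) ?sub0r ?opprK// oppr_ge0 ltW.
Qed.

Lemma ae_discrete (p : T -> Prop) : (\forall y \ae P, p y) ->
  forall i, 0 < w i -> p (x i).
Proof.
move=> [N [mN PN pN]] i wi; apply: contrapT => npi.
have xN : N (x i) by apply: pN => /= /npi.
move: PN; rewrite Pw// => -[] /eqP; rewrite psumr_eq0 => [/allP/(_ i)|j _].
  by rewrite mem_index_enum indicE mem_set// mulr1 gt_eqF// => /(_ isT).
by rewrite mulr_ge0.
Qed.

End discrete_law.

Section iid_discrete.
Context {d : measure_display} {T : measurableType d} {R : realType} {I : finType}.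

(** It reduces expectations over the sample to finite sums. *)
Lemma iid_law_discrete (Q : probability T R) (q : I -> R) (x : I -> T) n :
  (forall i, 0 <= q i) -> discrete_law Q q x ->
  discrete_law (iid_law Q n) (@prodw _ _ n q) (fun t => [tuple of map x t]).
Proof.
move=> q0 Qq; elim: n => [|n IH] S mS /=.
  rewrite (eq_bigr (fun=> \1_S [tuple])) => [|t _].
    by rewrite sumr_const card_tuple expn0.
  rewrite /prodw big_ord0 mul1r; congr (\1_S _); exact: tuple0.
rewrite /distribution /pushforward /product_measure1.
set B := _ @^-1` S.
have mB : measurable B.
  rewrite -[B]setTI; exact: measurable_consT.
rewrite (ge0_integral_discrete (x := x) q0 Qq)//; last first.
  exact: measurable_fun_xsection.
rewrite big_tuple_cons -sumEFin; apply: eq_bigr => i _.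
rewrite /= indicT mulr1 IH; last exact: measurable_xsection.
rewrite -EFinM mulr_sumr; congr EFin; apply: eq_bigr => t _.
rewrite prodw_cons mulrA; congr (_ * _).
rewrite !indicE; congr (_%:R); congr nat_of_bool.
rewrite mem_xsection.
have <- : consT (x i, [tuple of map x t]) = [tuple of map x [tuple of i :: t]].
  exact: val_inj.
by apply/idP/idP; rewrite !inE.
Qed.

End iid_discrete.

(** * From finite designs to the minimax excess risk *)

Section discrete_model.
Context {R : realType} {d : nat} {A : finType}.
Variables (w : A -> R) (x : A -> d.-tuple R) (g : d.-tuple R -> R).
Hypotheses (w0 : forall a, 0 <= w a) (w1 : \sum_a w a = 1).
Hypothesis mg : measurable_fun setT g.
Variables (PX : probability (d.-tuple R) R) (Q : probability (d.-tuple R * bool)%type R).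

Let q (z : A * bool) : R := w z.1 * sigm (sgb z.2 * g (x z.1)).
Let m (a : A) : R := 2 * sigm (g (x a)) - 1.

Hypothesis PXw : discrete_law PX w x.
Hypothesis Qq : discrete_law Q q (fun z => (x z.1, z.2)).

Lemma measurable_sigm : measurable_fun setT (sigm \o g).
Proof.
apply: measurableT_comp => //; apply: continuous_measurable_fun => y.
apply: cvgV; first by rewrite lt0r_neq0// addr_gt0 ?expR_gt0.
apply: cvgD; first exact: cvg_cst.
by apply: continuous_comp; [exact: opp_continuous|exact: continuous_expR].
Qed.

Let q0 z : 0 <= q z.
Proof. by rewrite mulr_ge0// ltW// sigm_gt0. Qed.

Lemma bernoulli_response_discrete : bernoulli_response PX (sigm \o g) Q.
Proof.
move=> S B mS; rewrite Qq; last exact: measurableX.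
have p01 y : 0 <= sigm (g y) <= 1 by rewrite !ltW ?sigm_gt0 ?sigm_lt1.
pose f (y : d.-tuple R) : R := sigm (g y) * \1_B true + (1 - sigm (g y)) * \1_B false.
rewrite (_ : (\int[PX]_(y in S) _)%E = (\int[PX]_(y in S) (f y)%:E)%E); last first.
  apply: eq_integral => y _; rewrite bernoulli_probE;last exact: p01.
  by rewrite /f [RHS]EFinD !EFinM.
rewrite (integral_discrete w0 PXw)//; last first.
  apply: measurable_funTS; apply: measurable_funD; apply: measurable_funM => //.
    exact: measurable_sigm.
  by apply: measurable_funB => //; exact: measurable_sigm.
congr EFin; rewrite -(pair_bigA _ (fun a b => q (a, b) * \1_(S `*` B) (x a, b))).
apply: eq_bigr => a _; rewrite big_bool /q /= /f.
have E b : \1_(S `*` B) (x a, b) = \1_S (x a) * \1_B b :> R.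
  by rewrite !indicE in_setX/= -natrM mulnb.
by rewrite !E mul1r mulN1r sigmN; ring.
Qed.

Definition error_prob a (e : bool) : R := (1 - sgb e * m a) / 2.

Lemma risk_discrete eta : measurable_fun setT eta ->
  risk Q eta = (\sum_a w a * error_prob a (eta (x a)))%:E.
Proof.
move=> meta; rewrite /risk Qq; last first.
  rewrite -[X in measurable X]setTI.
  have mh : measurable_fun setT (fun z : d.-tuple R * bool => z.2 != eta z.1).
    rewrite (_ : (fun z => _) = fun z => if z.2 then ~~ eta z.1 else eta z.1).
      apply: measurable_fun_ifT => //; last exact: measurableT_comp.
      by apply: measurable_neg; exact: measurableT_comp.
    by apply/funext => -[y []]; case: (eta y).
  exact: (mh measurableT [set true]).
congr EFin; rewrite -(pair_bigA _ (fun a b => q (a, b) *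
  \1_[set z | z.2 != eta z.1] (x a, b))).
apply: eq_bigr => a _; rewrite big_bool /q /= /error_prob /m.
rewrite !indicE (_ : ((x a, true) \in _) = ~~ eta (x a)); last first.
  by apply/idP/idP; rewrite inE /=; case: (eta (x a)).
rewrite (_ : ((x a, false) \in _) = eta (x a)); last first.
  by apply/idP/idP; rewrite inE /=; case: (eta (x a)).
by case: (eta (x a)); rewrite /= ?mul1r ?mulN1r ?sigmN; lra.
Qed.


Lemma measurable_bayes_classifier : measurable_fun setT (bayes_classifier (sigm \o g)).
Proof.
rewrite /bayes_classifier; apply: measurable_fun_ler => //.
exact: measurable_sigm.
Qed.

Lemma data_classifier_fiber n eta (D : n.-tuple (d.-tuple R * bool)) :
  data_classifier eta -> measurable_fun setT (eta D).
Proof.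
by move=> meta; exact: (measurableT_comp meta (pair1_measurable D)).
Qed.

Lemma excess_risk_discrete n (eta : n.-tuple (d.-tuple R * bool) -> d.-tuple R -> bool) :
  data_classifier eta ->
  excess_risk Q eta (bayes_classifier (sigm \o g)) =
  (\sum_(t : n.-tuple (A * bool)) prodw q t * \sum_a w a *
    ((`|m a| - sgb (eta [tuple of map (fun z => (x z.1, z.2)) t] (x a)) * m a) / 2))%:E.
Proof.
move=> meta; rewrite /excess_risk risk_discrete; last exact: measurable_bayes_classifier.
rewrite (eq_integral (fun D => (\sum_a w a * error_prob a (eta D (x a)))%:E)); last first.
  by move=> D _; rewrite risk_discrete//; exact: data_classifier_fiber.
rewrite (integral_discrete (fun t => prodw_ge0 t q0) (iid_law_discrete (n := n) q0 Qq))//; last first.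
  apply: measurable_sum => a; apply: measurable_funM => //.
  rewrite (_ : (fun D => _) = fun D => if eta D (x a) then error_prob a true
    else error_prob a false); last by apply/funext => D; case: ifP.
  apply: measurable_fun_ifT => //.
  exact: (measurableT_comp meta (pair2_measurable (x a))).
rewrite -EFinB; congr EFin.
have sumq : \sum_t @prodw _ _ n q t = 1.
  rewrite sum_prodw (_ : \sum_i q i = 1) ?expr1n//.
  exact: (@sum_label_weight R A unit w (fun _ a => g (x a)) w1 [ffun=> true]).
have bayesE a : sgb (bayes_classifier (sigm \o g) (x a)) * m a = `|m a|.
  rewrite /bayes_classifier /= sigm_ge_half -/(m a).
  by case: (leP 0 (m a)) => h; rewrite /sgb ?mul1r ?mulN1r ?(ger0_norm h) ?(ltr0_norm h).
rewrite -[X in _ - X = _]mul1r -[X in _ - X * _ = _]sumq mulr_suml -sumrB; apply: eq_bigr => t _.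
rewrite indicT mulr1 -mulrBr -sumrB; congr (_ * _); apply: eq_bigr => a _.
by rewrite -mulrBr /error_prob bayesE; congr (_ * _); lra.
Qed.

End discrete_model.

Section design_lower.
Context {R : realType} {d : nat} {A V : finType}.
Variables (n d0 : nat) (s rad : nat -> R).
Variables (w : A -> R) (x : A -> d.-tuple R).
Variable g : {ffun V -> bool} -> d.-tuple R -> R.
Variables (phi : V -> A -> R) (main : pred A) (b : V -> R) (rho : R).

(** The logits g th all belong to the model with the same design, so that the
   supremum dominates the excess risk under the worst of them, which
   finite_design_lower bounds uniformly over the classifiers. *)
Lemma design_lower :
  (forall a, 0 <= w a) -> \sum_a w a = 1 ->
  (forall PX : probability (d.-tuple R) R, discrete_law PX w x ->
    admissible_design PX /\ forall th, sparse_additive d0 s rad PX (g th)) ->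
  (forall th, measurable_fun setT (g th)) ->
  0 < rho -> rho <= 1 / 72 -> (forall v, 0 <= b v) -> \sum_v b v = rho ^+ 2 ->
  (forall th a, main a -> g th (x a) = \sum_v sgb (th v) * phi v a) ->
  (forall u : V -> R,
    \sum_(a | main a) w a * (\sum_v u v * phi v a) ^+ 2 <= \sum_v b v * u v ^+ 2) ->
  (forall a, main a -> \sum_v phi v a ^+ 2 <= 2 * rho ^+ 2) ->
  rho ^+ 2 / 2 <= \sum_(a | main a) w a * \sum_v phi v a ^+ 2 ->
  (forall v th, b v != 0 ->
    n%:R * (\sum_a w a * (g th (x a) - g (flip v th) (x a)) ^+ 2) <= 8 * (54 ^- 2) ^+ 2) ->
  ((rho / 72)%:E <= minimax_excess_risk n d d0 s rad)%E.
Proof.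
move=> w0 w1 model mg rho0 rho1 b0 b1 gE gram S_hi S_lo hell.
apply: le_ereal_inf_tmp => _ [eta meta <-].
have [PX PXw] := exists_discrete_law x w0 w1.
have [adm sa] := model PX PXw.
have [th] := @finite_design_lower R A V n w (fun th a => g th (x a)) w0 w1 phi main b rho
  rho0 rho1 b0 b1 gE gram S_hi S_lo hell
  (fun t a => eta [tuple of map (fun z => (x z.1, z.2)) t] (x a)).
set r := \sum_t _ => le_r.
pose q := label_weight w (fun th a => g th (x a)) th.
have [Q Qq] := exists_discrete_law (fun z : A * bool => (x z.1, z.2))
  (label_weight_ge0 (fun th a => g th (x a)) w0 th)
  (sum_label_weight (fun th a => g th (x a)) w1 th).
apply: (@le_trans _ _ r%:E); first by rewrite lee_fin.
apply: ereal_sup_ubound; exists PX, (sigm \o g th), Q; split; last first.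
  by rewrite (@excess_risk_discrete R d A w x (g th) w0 w1 (mg th) Q Qq n eta meta).
split => //.
- split; first exact: measurable_sigm.
  by move=> y; rewrite sigm_gt0 sigm_lt1.
- rewrite (_ : logit _ = g th)//; apply/funext => y.
  by rewrite /logit /= sigm_logit expRK.
- exact: (bernoulli_response_discrete w0 (mg th) PXw Qq).
Qed.

End design_lower.

(** * Cosine polynomials in the periodic Sobolev class *)

Section cosine_polynomials.
Context {R : realType}.
Implicit Types (t : R) (m k l : nat).

Definition cosnpi m t : R := cos (pi * m%:R * t).

Lemma sin_natpi m : sin (pi * m%:R) = 0 :> R.
Proof.
elim: m => [|m IH]; first by rewrite mulr0 sin0.
by rewrite -natr1 mulrDr mulr1 sinDpi IH oppr0.
Qed.

Lemma continuous_cosnpi m : continuous (cosnpi m).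
Proof.
move=> t; apply: continuous_comp; last exact: continuous_cos.
exact: mulrl_continuous.
Qed.

(** The second frequency is |k - l|, written with truncated differences. *)
Lemma cosnpiM k l t : cosnpi k t * cosnpi l t =
  (cosnpi (k + l) t + cosnpi ((k - l) + (l - k))%N t) / 2.
Proof.
wlog kl : k l / (l <= k)%N.
  move=> H; have [/H//|/ltnW/H h] := leqP l k.
  by rewrite mulrC h (addnC l k) (addnC (l - k)%N).
have -> : (l - k)%N = 0%N by apply/eqP; rewrite subn_eq0.
rewrite /cosnpi addn0 natrB// natrD mulrDr mulrBr mulrDl mulrBl cosD cosB.
lra.
Qed.

Local Notation itv01 := (`[0, 1] : set R)%classic.

Lemma integrable_continuous01 (f : R -> R) : continuous f ->
  lebesgue_measure.-integrable itv01 (EFin \o f).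
Proof.
move=> cf; apply: continuous_compact_integrable; first exact: segment_compact.
exact: continuous_subspaceT.
Qed.

Lemma Rintegral_cosnpi m : \int[lebesgue_measure]_(t in itv01) cosnpi m t = (m == 0)%:R.
Proof.
have [->|m0] := eqVneq m 0%N.
  rewrite (@eq_Rintegral _ _ _ _ _ (fun=> 1)) => [|t _].
    by rewrite Rintegral_cst//= mul1r lebesgue_measure_itv/= lte_fin ltr01 oppr0 adde0.
  by rewrite /cosnpi mulr0 mul0r cos0.
pose a : R := pi * m%:R.
have a0 : a != 0 by rewrite mulf_neq0 ?pnatr_eq0// gt_eqF// pi_gt0.
pose F t : R := a^-1 * sin (a * t).
have dF t : is_derive t 1 F (cosnpi m t).
  have daM : is_derive t 1 ( *%R a) a.
    by apply: (is_derive_eq (is_deriveZ a (is_derive_id t 1))); rewrite /GRing.scale/= mulr1.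
  have dsin := is_derive1_comp (is_derive_sin (a * t)) daM.
  apply: (is_derive_eq (is_deriveZ a^-1 dsin)).
  by rewrite /GRing.scale/= mulrCA mulVf// mulr1.
rewrite /Rintegral (@continuous_FTC2 _ _ F)//.
- by rewrite /F mulr1 mulr0 sin_natpi sin0 mulr0 sube0.
- by apply: continuous_subspaceT; exact: continuous_cosnpi.
- have cF : continuous F by move=> t; apply: differentiable_continuous; apply/derivable1_diffP; exact: ex_derive.
  split => [t _|//|]; first exact: ex_derive.
  + exact/cvg_at_right_filter/cF.
  + exact/cvg_at_left_filter/cF.
- by move=> t _; rewrite derive1E; exact: derive_val.
Qed.

Lemma Rintegral_cos_basis k l : \int[lebesgue_measure]_(t in itv01)
  (cos_basis k.+1 t * cos_basis l t) = (k.+1 == l)%:R.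
Proof.
case: l => [|l].
  transitivity (Num.sqrt 2 * \int[lebesgue_measure]_(t in itv01) cosnpi k.+1 t); last first.
    by rewrite Rintegral_cosnpi mulr0.
  rewrite -RintegralZl//; last first.
    exact/integrable_continuous01/continuous_cosnpi.
  by apply: eq_Rintegral => t _; rewrite /cos_basis mulr1.
transitivity (\int[lebesgue_measure]_(t in itv01) (cosnpi (k.+1 + l.+1) t +
    cosnpi ((k.+1 - l.+1) + (l.+1 - k.+1))%N t)).
  apply: eq_Rintegral => t _.
  rewrite /cos_basis mulrACA -expr2 sqr_sqrtr// -/(cosnpi _ _) -/(cosnpi _ _).
  by rewrite cosnpiM mulrC divfK.
rewrite RintegralD//; try exact/integrable_continuous01/continuous_cosnpi.
rewrite !Rintegral_cosnpi add0r; congr (nat_of_bool _)%:R; lia.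
Qed.

Definition cos_poly n (b : nat -> R) t : R := \sum_(l < n) b l * cos_basis l.+1 t.

Lemma continuous_cos_basis l : continuous (@cos_basis R l).
Proof.
case: l => [|l]; first by move=> t; exact: cvg_cst.
move=> t; apply: cvgM; [exact: cvg_cst|exact: continuous_cosnpi].
Qed.

Lemma continuous_cos_poly n b : continuous (cos_poly n b).
Proof.
elim: n => [|n IH] t.
  rewrite (_ : cos_poly 0 b = cst 0); first exact: cvg_cst.
  by apply/funext => u; rewrite /cos_poly big_ord0.
rewrite (_ : cos_poly n.+1 b = fun u => cos_poly n b u + b n * cos_basis n.+1 u).
  by apply: cvgD; [exact: IH|apply: cvgM; [exact: cvg_cst|exact: continuous_cos_basis]].
by apply/funext => u; rewrite /cos_poly big_ord_recr.
Qed.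

Lemma cos_coef_cos_poly n b k :
  cos_coef (cos_poly n b) k = \sum_(l < n) b l * (l.+1 == k)%:R.
Proof.
rewrite /cos_coef; elim: n => [|n IH].
  rewrite big_ord0 (@eq_Rintegral _ _ _ _ _ (fun=> 0)) => [|t _].
    by rewrite Rintegral_cst// mul0r.
  by rewrite /cos_poly big_ord0 mul0r.
rewrite big_ord_recr /= -IH -Rintegral_cos_basis -RintegralZl//; last 1 first.
  apply: integrable_continuous01 => t.
  by apply: cvgM; exact: continuous_cos_basis.
rewrite -RintegralD//.
- by apply: eq_Rintegral => t _; rewrite /cos_poly big_ord_recr /= mulrDl mulrA.
- apply: integrable_continuous01 => t.
  by apply: cvgM; [exact: continuous_cos_poly|exact: continuous_cos_basis].
- apply: integrable_continuous01 => t; apply: cvgM; first exact: cvg_cst.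
  by apply: cvgM; exact: continuous_cos_basis.
Qed.

Lemma periodic_sobolev_cos_poly n (b : nat -> R) (s rad : R) :
  \sum_(l < n) l.+1%:R `^ (2 * s) * b l ^+ 2 <= rad -> 0 < s ->
  periodic_sobolev s rad (cos_poly n b).
Proof.
move=> le_rad s0; have coef0 : cos_coef (cos_poly n b) 0 = 0.
  by rewrite cos_coef_cos_poly big1// => l _; rewrite mulr0.
have coefS (l : 'I_n) : cos_coef (cos_poly n b) l.+1 = b l.
  rewrite cos_coef_cos_poly (bigD1 l)//= eqxx mulr1 big1 ?addr0// => j jl.
  by rewrite eqSS (negbTE (jl : (j : nat) != l)) mulr0.
have coef_big l : (n < l)%N -> cos_coef (cos_poly n b) l = 0.
  move=> nl; rewrite cos_coef_cos_poly big1// => j _.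
  by rewrite ltn_eqF ?mulr0// (leq_ltn_trans _ nl).
split => //.
  by apply: continuous_subspaceT; exact: continuous_cos_poly.
rewrite (nneseries_split _ n.+1); last first.
  by move=> k _; rewrite lee_fin mulr_ge0 ?powR_ge0 ?sqr_ge0.
rewrite add0n eseries0 ?adde0; last first.
  by move=> k nk _; rewrite coef_big// expr0n mulr0.
rewrite big_mkord sumEFin lee_fin big_ord_recl coef0 expr0n mulr0 add0r.
apply: le_trans le_rad; apply: ler_sum => l _.
by rewrite coefS.
Qed.

End cosine_polynomials.

(** * Additive logits under a finite design *)

Section discrete_design.
Context {R : realType} {d : nat} {A : finType}.
Variables (w : A -> R) (x : A -> d.-tuple R) (PX : probability (d.-tuple R) R).
Hypotheses (w0 : forall a, 0 <= w a) (w1 : \sum_a w a = 1).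
Hypotheses (xcube : forall a, unit_cube (x a)) (PXw : discrete_law PX w x).

Lemma measurable_unit_cube : measurable (@unit_cube R d).
Proof.
rewrite (_ : unit_cube = \bigcap_(j in [set: 'I_d])
    ((fun y : d.-tuple R => tnth y j) @^-1` `[0, 1])); last first.
  by apply/seteqP; split => [y cy j _|y cy j]; exact: cy.
apply: fin_bigcap_measurable; first exact: finite_finset.
by move=> j _; rewrite -[X in measurable X]setTI; exact: measurable_tnth.
Qed.

Lemma indic_cube a : \1_unit_cube (x a) = 1 :> R.
Proof. by rewrite indicE mem_set. Qed.

Lemma admissible_discrete :
  (forall c : 'I_d -> R, (forall a, 0 < w a -> \sum_j c j * tnth (x a) j = 0) ->
    forall j, c j = 0) ->
  admissible_design PX.
Proof.
move=> indep; split=> [|c ae_c].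
  rewrite PXw; last exact: measurable_unit_cube.
  by under eq_bigr do rewrite indic_cube mulr1; rewrite w1.
apply: indep => a wa; exact: (ae_discrete w0 PXw ae_c wa).
Qed.

Lemma Lfun2_discrete (g : d.-tuple R -> R) : measurable_fun setT g ->
  g \in Lfun PX 2%:E.
Proof.
move=> mg; apply/andP; split; rewrite inE/=; first exact: mg.
rewrite /finite_norm unlock /=.
rewrite (integral_discrete w0 PXw)//; first by rewrite poweR_EFin ltry.
apply: (measurableT_comp (measurable_powR _)).
exact: measurableT_comp.
Qed.

(** The active set is the range of kappa.  It may depend on the logit, as it does
   for the selection term, while the enumeration e of the features that carries
   the smoothness stays the same. *)
Lemma sparse_additive_discrete d0 (s rad : nat -> R) (kappa : 'I_d0 -> 'I_d)
    (e : 'I_d -> 'I_d0) (h : 'I_d0 -> R -> R) :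
  cancel kappa e -> (forall k : 'I_d0, continuous (h k)) ->
  (forall k : 'I_d0, periodic_sobolev (s k) (rad k) (h k)) ->
  (forall k, \sum_a w a * h k (tnth (x a) (kappa k)) = 0) ->
  sparse_additive d0 s rad PX (fun y => \sum_k h k (tnth y (kappa k))).
Proof.
move=> kappaK ch sob centered.
have mh j : measurable_fun setT (fun y : d.-tuple R => h (e j) (tnth y j)).
  apply: measurableT_comp; last exact: measurable_tnth.
  exact: continuous_measurable_fun.
split.
  apply: Lfun2_discrete; apply: measurable_sum => k.
  by have := mh (kappa k); rewrite kappaK.
exists 0, [set kappa k | k : 'I_d0]%SET, e, (fun j => h (e j)).
have inJ j : j \in [set kappa k | k : 'I_d0]%SET -> kappa (e j) = j.
  by move=> /imsetP[k _ ->]; rewrite kappaK.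
split.
- by rewrite -[leqRHS]card_ord; exact: leq_imset_card.
- by move=> i j /inJ iJ /inJ jJ eij; rewrite -iJ -jJ eij.
- by move=> j _; exact: sob.
- move=> j /inJ jJ.
  rewrite (integral_discrete w0 PXw); last 2 first.
  + exact: measurable_unit_cube.
  + by apply: measurable_funTS; exact: mh.
  transitivity (\sum_a w a * h (e j) (tnth (x a) (kappa (e j))))%:E; last first.
    by rewrite centered.
  congr EFin; apply: eq_bigr => a _.
  by rewrite indic_cube mulr1 jJ.
- move=> y _; rewrite add0r big_imset/=; last by move=> i j _ _ /(can_inj kappaK).
  by apply: eq_bigr => k _; rewrite kappaK.
Qed.

End discrete_design.

(** * The estimation term: a product grid *)

Lemma sum_pair (R : nmodType) (I J : finType) (F : I * J -> R) :
  \sum_v F v = \sum_i \sum_j F (i, j).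
Proof. by rewrite pair_big /=; apply: eq_bigr => -[]. Qed.

Section cosine_grid.
Context {R : realType} (n : nat).
Local Notation M := n.+1.

(** Midpoints, and not the points k / n.+1: on these nodes the cosines of
   frequency below n.+1 are orthogonal to each other and to the constants. *)
Definition grid_point (k : 'I_M) : R := (k%:R + 1 / 2) / M%:R.

Lemma grid_point_itv k : grid_point k \in `[0, 1].
Proof.
rewrite in_itv /= /grid_point divr_ge0 ?addr_ge0//= ler_pdivrMr ?ltr0n// mul1r.
have : (k.+1%:R : R) <= M%:R by rewrite ler_nat ltn_ord.
by rewrite -natr1; lra.
Qed.

Definition grid_mean (f : 'I_M -> R) : R := \sum_k M%:R^-1 * f k.

Lemma grid_mean_cst c : grid_mean (fun=> c) = c.
Proof.
rewrite /grid_mean sumr_const card_ord -[LHS]mulr_natl mulrA divff ?mul1r//.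
Qed.

(** Multiplied by 2 sin h with h = pi m / (2 n + 2), the sum telescopes to
   sin (pi m) = 0, and sin h > 0 since 0 < h < pi. *)
Lemma grid_mean_cosnpi m : (0 < m < M.*2)%N ->
  grid_mean (fun k => cosnpi m (grid_point k)) = 0.
Proof.
move=> /andP[m0 mM]; rewrite /grid_mean -mulr_sumr; apply/eqP; rewrite mulf_eq0.
apply/orP; right; apply/eqP.
pose h : R := pi * m%:R / (M.*2)%:R.
have M0 : 0 < (M.*2)%:R :> R by rewrite ltr0n.
have Mneq0 : M%:R != 0 :> R by rewrite pnatr_eq0.
have sinh : 0 < sin h.
  apply: sin_gt0_pi; rewrite divr_gt0 ?mulr_gt0 ?pi_gt0 ?ltr0n//=.
  by rewrite ltr_pdivrMr// ltr_pM2l ?pi_gt0// ltr_nat.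
have E (k : nat) : 2 * sin h * cos (pi * m%:R * ((k%:R + 1 / 2) / M%:R)) =
    sin (h * 2 * k.+1%:R) - sin (h * 2 * k%:R).
  have -> : pi * m%:R * ((k%:R + 1 / 2) / M%:R) = h * 2 * k%:R + h.
    by rewrite /h -muln2 natrM; move: (M%:R : R) Mneq0 => X X0; field.
  have -> : h * 2 * k.+1%:R = (h * 2 * k%:R + h) + h by rewrite -natr1; ring.
  have -> : sin (h * 2 * k%:R) = sin ((h * 2 * k%:R + h) - h) by congr sin; ring.
  by rewrite [in RHS]sinD [in RHS]sinB; ring.
have tele (p : nat) : \sum_(k < p) 2 * sin h * cos (pi * m%:R * ((k%:R + 1 / 2) / M%:R)) =
    sin (h * 2 * p%:R).
  elim: p => [|p IH]; first by rewrite big_ord0 mulr0 sin0.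
  by rewrite big_ord_recr /= IH E; ring.
have := tele M; rewrite -mulr_sumr (_ : h * 2 * M%:R = pi * m%:R).
  by rewrite sin_natpi => /eqP; rewrite !mulf_eq0 pnatr_eq0/= (gt_eqF sinh) => /eqP.
by rewrite /h -muln2 natrM; move: (M%:R : R) Mneq0 => X X0; field.
Qed.

Lemma grid_mean_cos_basis l : (l < n)%N ->
  grid_mean (fun k => cos_basis l.+1 (grid_point k)) = 0.
Proof.
move=> ln; rewrite /grid_mean /cos_basis.
rewrite (eq_bigr (fun k => Num.sqrt 2 * (M%:R^-1 * cosnpi l.+1 (grid_point k)))) => [|k _].
  by rewrite -mulr_sumr [X in _ * X]grid_mean_cosnpi ?mulr0//; lia.
by rewrite mulrCA.
Qed.

Lemma grid_mean_cos_basisM k l : (k < n)%N -> (l < n)%N ->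
  grid_mean (fun i => cos_basis k.+1 (grid_point i) * cos_basis l.+1 (grid_point i))
    = (k == l)%:R.
Proof.
move=> kn ln; transitivity (grid_mean (fun i => cosnpi (k.+1 + l.+1) (grid_point i)) +
  grid_mean (fun i => cosnpi ((k.+1 - l.+1) + (l.+1 - k.+1))%N (grid_point i))).
  rewrite /grid_mean -big_split /=; apply: eq_bigr => i _; rewrite -mulrDr; congr (_ * _).
  rewrite /cos_basis mulrACA -expr2 sqr_sqrtr// -/(cosnpi _ _) -/(cosnpi _ _).
  by rewrite cosnpiM mulrC divfK.
rewrite grid_mean_cosnpi ?add0r; last by lia.
have [->|kl] := eqVneq k l; last by rewrite grid_mean_cosnpi//; lia.
rewrite subnn addn0 -[RHS](grid_mean_cst 1); apply: eq_bigr => i _.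
by rewrite /cosnpi mulr0 mul0r cos0.
Qed.

Lemma cos_basis_sqr_le2 l (t : R) : cos_basis l t ^+ 2 <= 2.
Proof.
case: l => [|l]; first by rewrite expr1n; lra.
rewrite /cos_basis exprMn sqr_sqrtr; last by [].
have := cos2Dsin2 (pi * l.+1%:R * t); have := sqr_ge0 (sin (pi * l.+1%:R * t)).
by lra.
Qed.

Section product_grid.
Variable d : nat.

(** The constant is written as a product over the features, which makes the
   means of products factorize. *)
Definition grid_weight (a : {ffun 'I_d -> 'I_M}) : R := \prod_(j < d) M%:R^-1.

Lemma grid_weight_gt0 a : 0 < grid_weight a.
Proof. by apply: prodr_gt0 => j _; rewrite invr_gt0 ltr0n. Qed.

Lemma sum_grid_prod (F : 'I_d -> 'I_M -> R) :
  \sum_a grid_weight a * (\prod_j F j (a j)) = \prod_j grid_mean (F j).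
Proof.
rewrite bigA_distr_bigA; apply: eq_bigr => a _.
by rewrite /grid_weight -big_split.
Qed.

Lemma sum_grid_weight : \sum_a grid_weight a = 1.
Proof.
rewrite (eq_bigr (fun a => grid_weight a * (\prod_(j < d) 1))) => [|a _].
  by rewrite (sum_grid_prod (fun _ _ => 1)) big1// => j _; exact: grid_mean_cst.
by rewrite big1_eq mulr1.
Qed.

Lemma sum_grid1 (i : 'I_d) f : \sum_a grid_weight a * f (a i) = grid_mean f.
Proof.
have := sum_grid_prod (fun j k => if j == i then f k else 1).
rewrite [RHS](bigD1 i)//= eqxx [X in _ * X]big1 ?mulr1 => [<-|j /negbTE ->]; last first.
  exact: grid_mean_cst.
apply: eq_bigr => a _; congr (_ * _).
by rewrite (bigD1 i)//= eqxx big1 ?mulr1// => j /negbTE ->.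
Qed.

Lemma sum_grid2 (i j : 'I_d) f g : i != j ->
  \sum_a grid_weight a * (f (a i) * g (a j)) = grid_mean f * grid_mean g.
Proof.
move=> ij; have ji : j != i by rewrite eq_sym.
have := sum_grid_prod (fun l k => if l == i then f k else if l == j then g k else 1).
rewrite [RHS](bigD1 i)//= eqxx (bigD1 j)//= (negbTE ji) eqxx.
rewrite [X in _ * (_ * X)]big1 ?mulr1 => [<-|l /andP[/negbTE -> /negbTE ->]]; last first.
  exact: grid_mean_cst.
apply: eq_bigr => a _; congr (_ * _).
rewrite (bigD1 i)//= eqxx (bigD1 j)//= (negbTE ji) eqxx big1 ?mulr1//.
by move=> l /andP[/negbTE -> /negbTE ->].
Qed.

End product_grid.

End cosine_grid.

Section grid_lower.
Context {R : realType} (n d d0 : nat) (s rad : nat -> R) (N : 'I_d0 -> nat) (amp : R).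
Hypotheses (n_gt0 : (0 < n)%N) (d0_gt0 : (0 < d0)%N) (le_d : (d0 <= d)%N).
Hypotheses (N_gt0 : forall j, (0 < N j)%N) (N_le : forall j, (N j <= n)%N).
Hypothesis amp_gt0 : 0 < amp.

Let V := ('I_d0 * 'I_n)%type.
Let A := {ffun 'I_d -> 'I_n.+1}.
Let x (a : A) : d.-tuple R := [tuple @grid_point R n (a j) | j < d].
Let kappa := widen_ord le_d.
Let e (j : 'I_d) : 'I_d0 := insubd (Ordinal d0_gt0) (val j).
Let active (v : V) : R := (v.2 < N v.1)%:R.
Let psi (v : V) (a : A) : R := cos_basis v.2.+1 (@grid_point R n (a (kappa v.1))).
Let phi (v : V) (a : A) : R := amp * active v * psi v a.
Let b (v : V) : R := amp ^+ 2 * active v.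
(** The coefficient of the cosine of frequency l.+1 in component j.  Frequencies
   beyond N j are switched off by active, which avoids an index type that
   depends on j. *)
Let coef (th : {ffun V -> bool}) (j : 'I_d0) (l : nat) : R :=
  if insub l is Some l' then amp * active (j, l') * sgb (th (j, l')) else 0.
Let g (th : {ffun V -> bool}) (y : d.-tuple R) : R :=
  \sum_j cos_poly n (coef th j) (tnth y (kappa j)).
Let w := @grid_weight R n d.

Let kappaK : cancel kappa e.
Proof. by move=> j; apply: val_inj; rewrite /e val_insubd /= ltn_ord. Qed.

Let activeX v : active v ^+ 2 = active v.
Proof. by rewrite /active; case: (_ < _)%N; rewrite ?expr1n ?expr0n. Qed.

Let gE th a : g th (x a) = \sum_v sgb (th v) * phi v a.
Proof.
rewrite [RHS]sum_pair.
apply: eq_bigr => j _; apply: eq_bigr => l _; rewrite /coef valK tnth_mktuple.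
by rewrite /phi /psi /=; ring.
Qed.

(** For distinct features the mean factorizes and each factor vanishes; for the
   same feature this is the orthonormality of the cosines on the grid. *)
Let covar u v : \sum_a w a * (phi u a * phi v a) = (u == v)%:R * b v.
Proof.
rewrite (eq_bigr (fun a => amp ^+ 2 * active u * active v * (w a * (psi u a * psi v a)))).
  rewrite -mulr_sumr.
  have -> : \sum_a w a * (psi u a * psi v a) = (u == v)%:R.
    case: u v => [i k] [j l]; rewrite xpair_eqE; have [<-|ij] /= := eqVneq i j.
      rewrite (sum_grid1 (kappa i) (fun c => cos_basis k.+1 (@grid_point R n c) *
        cos_basis l.+1 (@grid_point R n c))).
      by rewrite grid_mean_cos_basisM.
    rewrite (@sum_grid2 R n d (kappa i) (kappa j) (fun c => cos_basis k.+1 (@grid_point R n c))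
      (fun c => cos_basis l.+1 (@grid_point R n c))).
      by rewrite grid_mean_cos_basis// mul0r.
    by apply: contraNneq ij => /(can_inj kappaK) ->.
  have [->|_] := eqVneq u v; last by rewrite mulr0 mul0r.
  by rewrite mulr1 mul1r -mulrA -expr2 activeX.
by move=> a _; rewrite /phi; ring.
Qed.

Let sum_active j : \sum_(l < n) active (j, l) = (N j)%:R.
Proof.
rewrite -natr_sum; congr _%:R.
rewrite -(big_mkord predT (fun l => (l < N j)%N : nat)) (big_cat_nat (n := N j))//=.
rewrite [X in (_ + X)%N]big_nat_cond [X in (_ + X)%N]big1 ?addn0; last first.
  by move=> l /andP[/andP[Nl _] _]; rewrite ltnNge Nl.
rewrite big_nat_cond (eq_bigr (fun=> 1%N)); last by move=> l /andP[/andP[_ ->]].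
by rewrite -big_nat_cond sum_nat_const_nat subn0 muln1.
Qed.

Let sum_b : \sum_v b v = amp ^+ 2 * (\sum_j N j)%:R.
Proof.
rewrite sum_pair natr_sum mulr_sumr.
by apply: eq_bigr => j _; rewrite /b -mulr_sumr sum_active.
Qed.

Let b_ge0 v : 0 <= b v.
Proof. by rewrite mulr_ge0 ?sqr_ge0. Qed.

Let gram (u : V -> R) :
  \sum_a w a * (\sum_v u v * phi v a) ^+ 2 = \sum_v b v * u v ^+ 2.
Proof.
rewrite (eq_bigr (fun a => \sum_v \sum_v' u v * u v' * (w a * (phi v a * phi v' a)))).
  rewrite exchange_big /=; apply: eq_bigr => v _; rewrite exchange_big /=.
  rewrite (eq_bigr (fun v' => u v * u v' * ((v == v')%:R * b v'))) => [|v' _].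
    rewrite (bigD1 v)//= eqxx big1 ?addr0 => [|v' vv']; first by rewrite mul1r; ring.
    by rewrite eq_sym (negbTE vv') mul0r mulr0.
  by rewrite -mulr_sumr covar.
move=> a _; rewrite expr2 mulr_suml mulr_sumr; apply: eq_bigr => v _.
by rewrite !mulr_sumr; apply: eq_bigr => v' _; ring.
Qed.

(** The flip of an active sign changes the logit by 2 phi v, whose mean square
   is 4 amp^2, of order 1 / n; the size of the logit is amp sqrt (sum_j N j). *)
Lemma grid_lower :
  (forall j : 'I_d0, 0 < s j) ->
  (forall j : 'I_d0, (N j)%:R * (N j)%:R `^ (2 * s j) * amp ^+ 2 <= rad j) ->
  n%:R * amp ^+ 2 <= 2 * (54 ^- 2) ^+ 2 ->
  amp ^+ 2 * (\sum_j N j)%:R <= (1 / 72) ^+ 2 ->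
  ((amp * Num.sqrt (\sum_j N j)%:R / 72)%:E <= minimax_excess_risk n d d0 s rad)%E.
Proof.
move=> s_gt0 le_rad n_amp rho_le.
pose rho := amp * Num.sqrt (\sum_j N j)%:R.
have rho2 : rho ^+ 2 = amp ^+ 2 * (\sum_j N j)%:R by rewrite exprMn sqr_sqrtr.
have rho0 : 0 < rho.
  rewrite mulr_gt0// sqrtr_gt0 ltr0n (bigD1 (Ordinal d0_gt0))//=.
  by rewrite addn_gt0 N_gt0.
have w0 a : 0 <= w a by exact/ltW/grid_weight_gt0.
have sum_phi2 v : \sum_a w a * phi v a ^+ 2 = b v.
  by under eq_bigr do rewrite expr2; rewrite covar eqxx mul1r.
apply: (@design_lower R d A V n d0 s rad w x g phi predT b rho) => //.
- exact: sum_grid_weight.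
- move=> PX PXw.
  have xcube a : unit_cube (x a).
    by move=> j; rewrite tnth_mktuple; exact: grid_point_itv.
  split.
    apply: (admissible_discrete w0 _ xcube PXw); first exact: sum_grid_weight.
    move=> c indep j.
    pose a0 : A := [ffun=> ord0]; pose a1 : A := [ffun i => if i == j then inord 1 else ord0].
    have := indep a0 (grid_weight_gt0 _); have := indep a1 (grid_weight_gt0 _).
    rewrite (bigD1 j)//= [X in _ -> X = _ -> _](bigD1 j)//= !tnth_mktuple !ffunE eqxx.
    rewrite (eq_bigr (fun i => c i * tnth (x a0) i)) => [|i ij]; last first.
      by rewrite !tnth_mktuple !ffunE (negbTE ij).
    set S := \sum_(i < d | _) _ => h1 h0.
    have : c j * (@grid_point R n (inord 1 : 'I_n.+1) - @grid_point R n (ord0 : 'I_n.+1)) = 0.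
      by rewrite mulrBr; move: h1 h0; set u := c j * _; set v := c j * _; lra.
    rewrite /grid_point inordK//= -mulrBl => /eqP; rewrite !mulf_eq0 invr_eq0 pnatr_eq0 orbF.
    by case/orP => /eqP //; lra.
  move=> th; apply: (@sparse_additive_discrete R d A w x PX w0 xcube PXw d0 s rad
    kappa e (fun j => cos_poly n (coef th j)) kappaK).
  + by move=> k; exact: continuous_cos_poly.
  + move=> k; apply: periodic_sobolev_cos_poly => //; apply: le_trans (le_rad k).
    apply: (@le_trans _ _ (\sum_(l < n) active (k, l) * ((N k)%:R `^ (2 * s k) * amp ^+ 2))).
      apply: ler_sum => l _; rewrite /coef valK !exprMn sgb_sqr mulr1 activeX.
      rewrite (_ : _ * (amp ^+ 2 * _) =
        active (k, l) * (l.+1%:R `^ (2 * s k) * amp ^+ 2)); last by ring.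
      rewrite /active /=; case: ltnP => [lN|_]; last by rewrite !mul0r.
      rewrite !mul1r ler_wpM2r ?sqr_ge0//; apply: ge0_ler_powR; rewrite ?nnegrE ?ler0n ?ler_nat//.
      by rewrite mulr_ge0// ltW.
    by rewrite -mulr_suml sum_active -mulrA.
  + move=> k.
    under eq_bigr do rewrite tnth_mktuple.
    rewrite (sum_grid1 (kappa k) (fun c => cos_poly n (coef th k) (grid_point c))).
    rewrite /grid_mean /cos_poly.
    under eq_bigr do rewrite mulr_sumr.
    rewrite exchange_big big1//= => l _.
    under eq_bigr do rewrite mulrCA.
    by rewrite -mulr_sumr [X in _ * X]grid_mean_cos_basis ?mulr0.
- move=> th; apply: measurable_sum => k; apply: measurableT_comp; last exact: measurable_tnth.
  by apply: continuous_measurable_fun; exact: continuous_cos_poly.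
- rewrite -(@ler_pXn2r _ 2) ?nnegrE ?(ltW rho0)//; last by lra.
  by rewrite rho2.
- by move=> u; rewrite gram.
- move=> a _; rewrite rho2 -sum_b mulr_sumr; apply: ler_sum => v _.
  rewrite exprMn exprMn activeX -/(b v) [leRHS]mulrC.
  by apply: ler_wpM2l; [exact: b_ge0|exact: cos_basis_sqr_le2].
- rewrite (_ : \sum_a _ = rho ^+ 2).
    by have := sqr_ge0 rho; lra.
  rewrite rho2 -sum_b; under eq_bigr do rewrite mulr_sumr.
  by rewrite exchange_big /=; apply: eq_bigr => v _; exact: sum_phi2.
- move=> v th _.
  rewrite (eq_bigr (fun a => 4 * (w a * phi v a ^+ 2))) => [|a _].
    rewrite -mulr_sumr sum_phi2 /b /active; case: (_ < _)%N; last by rewrite !mulr0; lra.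
    by rewrite mulr1; lra.
  rewrite !gE -sumrB (bigD1 v)//= flip_at sgbN big1 ?addr0.
    set p := phi v a; have := @sgb_sqr R (th v).
    rewrite (_ : (_ - _) ^+ 2 = sgb (th v) ^+ 2 * (4 * p ^+ 2)) => [->|]; ring.
  by move=> u uv; rewrite flip_out// subrr.
Qed.

End grid_lower.

(** * The selection term: features labelled by words *)

Section selection_lower.
Context {R : realType} (n d d0 k : nat) (s rad : nat -> R) (eps : R).
Hypotheses (d0_gt0 : (0 < d0)%N) (k_gt0 : (0 < k)%N) (le_d : (d0 * 2 ^ k <= d)%N).
Hypothesis eps_gt0 : 0 < eps.

Let word := {ffun 'I_k -> bool}.
Let U := ('I_d0 * word)%type.
Let V := ('I_d0 * 'I_k)%type.
Let A := ((V * bool) + ('I_d * bool))%type.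

Let card_U : (#|{: U}| <= d)%N.
Proof. by rewrite card_prod card_ffun card_bool !card_ord. Qed.

Let iota (u : U) : 'I_d := widen_ord card_U (enum_rank u).
(** The group and the word of a feature; None for the features which no word
   labels. *)
Let label (j : 'I_d) : option U :=
  omap enum_val (insub (val j) : option 'I_#|{: U}|).

Let iotaK u : label (iota u) = Some u.
Proof.
rewrite /label /iota /=; have -> : insub (enum_rank u : nat) = Some (enum_rank u).
  exact: valK.
by rewrite /= enum_rankK.
Qed.

Let e (j : 'I_d) : 'I_d0 := if label j is Some u then u.1 else Ordinal d0_gt0.
(** In the group b the signs of th select the feature whose word spells them. *)
Let kappa (th : {ffun V -> bool}) (b : 'I_d0) : 'I_d := iota (b, [ffun i => th (b, i)]).

Let kappaK th : cancel (kappa th) e.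
Proof. by move=> b; rewrite /e iotaK. Qed.

(** The features are 1/2 - z / 2 with z in {-1, 0, 1}, and cos (pi x) = z there.
   At the atom (b, i) the features of the group b display the i-th letter of
   their word, and all others are neutral.  The atoms of the second kind move
   one feature only: they make the features linearly independent.  Every atom
   comes with its opposite, which centers all components. *)
Let base (a : V + 'I_d) (j : 'I_d) : R :=
  match a with
  | inl v => if label j is Some u then (if u.1 == v.1 then sgb (u.2 v.2) else 0) else 0
  | inr j' => (j == j')%:R
  end.
Let z (a : A) (j : 'I_d) : R :=
  match a with
  | inl (v, sg) => sgb sg * base (inl v) j
  | inr (j', sg) => sgb sg * base (inr j') j
  end.

Let x (a : A) : d.-tuple R := [tuple (1 - z a j) / 2 | j < d].

Let trit (t : R) := [\/ t = -1, t = 0 | t = 1].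

Let z_trit a j : trit (z a j).
Proof.
have tb sg c : trit c -> trit (sgb sg * c).
  by rewrite /sgb; case: sg => -[] ->; rewrite ?mul1r ?mulN1r ?oppr0 ?opprK; constructor.
case: a => [[v sg]|[j' sg]] /=; apply: tb.
  case: (label j) => [u|]; last by constructor.
  by case: ifP => _; [rewrite /sgb; case: ifP => _|]; constructor.
by case: (j == j'); constructor.
Qed.

Let h : R -> R := cos_poly 1 (fun=> eps / Num.sqrt 2).

Let h_trit t : trit t -> h ((1 - t) / 2) = eps * t.
Proof.
have -> : h ((1 - t) / 2) = eps * cos (pi * ((1 - t) / 2)).
  by rewrite /h /cos_poly big_ord1 /cos_basis mulr1 mulrA divfK// gt_eqF// sqrtr_gt0.
move=> [] ->; congr (_ * _).
- by rewrite opprK -[RHS]cospi; congr cos; lra.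
- by rewrite subr0 mulrA mulr1 cos_pihalf.
- by rewrite subrr mul0r mulr0 cos0.
Qed.

Let g (th : {ffun V -> bool}) (y : d.-tuple R) : R := \sum_b h (tnth y (kappa th b)).

Let gz th a : g th (x a) = eps * \sum_b z a (kappa th b).
Proof.
rewrite mulr_sumr; apply: eq_bigr => b _.
by rewrite tnth_mktuple h_trit.
Qed.

Let phi (v : V) (a : A) : R :=
  if a is inl (v', sg) then (v == v')%:R * (eps * sgb sg) else 0.

Let main (a : A) : bool := if a is inl _ then true else false.

(** In the group b only the selected feature contributes, and the i-th letter of
   its word is the sign th (b, i): all sign patterns occur with the same
   margin eps. *)
Let g_main th a : main a -> g th (x a) = \sum_v sgb (th v) * phi v a.
Proof.
case: a => // -[[b i] sg] _; rewrite gz.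
rewrite (bigD1 b)//= [X in _ * (_ + X)]big1 ?addr0; last first.
  by move=> b' b'b; rewrite iotaK /= (negbTE b'b) mulr0.
rewrite iotaK /= eqxx ffunE.
rewrite (bigD1 (b, i))//= eqxx big1 ?addr0; last first.
  by move=> v /negbTE ->; rewrite mul0r mulr0.
by rewrite mul1r; ring.
Qed.

Let g_side th j sg : `|g th (x (inr (j, sg)))| <= eps.
Proof.
rewrite gz (bigD1 (e j))//= [X in _ * (_ + X)]big1 ?addr0; last first.
  move=> b bj; rewrite (_ : (_ == _) = false) ?mulr0//.
  by apply: contra_neqF bj => /eqP <-; rewrite kappaK.
rewrite normrM gtr0_norm// normrM normr_sgb mul1r -[leRHS]mulr1 ler_wpM2l ?(ltW eps_gt0)//.
by case: (_ == _); rewrite ?normr1 ?normr0.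
Qed.

Let Vn : R := (d0 * k)%:R.
Let Vn_ge1 : 1 <= Vn.
Proof. by rewrite -[leLHS]/(1%:R) ler_nat muln_gt0 d0_gt0. Qed.

(** The total weight of the atoms of the second kind.  They reveal whether a
   feature is selected, so that their weight must not exceed the order of the
   weight attached to a single sign. *)
Let delta : R := (2 * Vn)^-1.
Let w (a : A) : R := if a is inl _ then (1 - delta) / (2 * Vn) else delta / (2 * d%:R).

Let d_gt0 : 0 < d%:R :> R.
Proof.
rewrite ltr0n; apply: leq_trans le_d; by rewrite muln_gt0 d0_gt0 expn_gt0.
Qed.

Let delta_gt0 : 0 < delta.
Proof. by rewrite invr_gt0 mulr_gt0// (lt_le_trans ltr01). Qed.

Let delta_le : delta <= 1 / 2.
Proof.
rewrite /delta invfM div1r -[leRHS]mulr1 ler_wpM2l// invf_le1//.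
exact: lt_le_trans Vn_ge1.
Qed.

Let w_gt0 a : 0 < w a.
Proof.
have V0 : 0 < Vn by exact: lt_le_trans Vn_ge1.
case: a => a; rewrite /w divr_gt0 ?mulr_gt0//.
by have := delta_le; lra.
Qed.

Let sum_atoms (F : A -> R) : \sum_a w a * F a =
  (1 - delta) / (2 * Vn) * (\sum_v (F (inl (v, true)) + F (inl (v, false)))) +
  delta / (2 * d%:R) * (\sum_j (F (inr (j, true)) + F (inr (j, false)))).
Proof.
rewrite big_sumType /= -!mulr_sumr; congr (_ * _ + _ * _); rewrite sum_pair.
  by apply: eq_bigr => v _; rewrite big_bool.
by apply: eq_bigr => v _; rewrite big_bool.
Qed.

Let sum_main (F : A -> R) : \sum_(a | main a) w a * F a =
  (1 - delta) / (2 * Vn) * (\sum_v (F (inl (v, true)) + F (inl (v, false)))).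
Proof.
rewrite (eq_bigr (fun a => w a * (if main a then F a else 0))) => [|a ->//].
rewrite (_ : \sum_(a | main a) _ = \sum_a w a * (if main a then F a else 0)).
  by rewrite sum_atoms /= [X in _ + _ * X]big1 ?mulr0 ?addr0//.
rewrite [RHS](bigID main) /= [X in _ + X]big1 ?addr0// => a /negbTE ->.
by rewrite mulr0.
Qed.

Let sum_cst (I : finType) (c : R) : \sum_(i : I) c = #|I|%:R * c.
Proof. by rewrite sumr_const mulr_natl. Qed.

Let card_V : #|{: V}|%:R = Vn.
Proof. by rewrite card_prod !card_ord. Qed.

Let sum_w : \sum_a w a = 1.
Proof.
have := sum_atoms (fun=> 1); under eq_bigr do rewrite mulr1.
move=> ->; rewrite !sum_cst card_V card_ord.
have V0 : Vn != 0 by rewrite gt_eqF// (lt_le_trans ltr01).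
have dn0 : d%:R != 0 :> R by rewrite gt_eqF.
by move: (Vn) (d%:R) V0 dn0 (delta) => V' D V0 D0 dl; field; rewrite D0.
Qed.

Let sum_phi2 a : main a -> \sum_v phi v a ^+ 2 = eps ^+ 2.
Proof.
case: a => // -[v sg] _; rewrite (bigD1 v)//= eqxx big1 ?addr0.
  by rewrite mul1r exprMn sgb_sqr mulr1.
by move=> v' /negbTE ->; rewrite mul0r expr0n.
Qed.

(** The flip of one sign moves two atoms of the first kind, of total weight at
   most 1 / (d0 k), by 2 eps, and replaces the selected feature of one group;
   at the atoms of the second kind the logit stays below eps, whence a squared
   change of at most 4 eps^2 on weight delta. *)
Lemma selection_lower :
  (forall j : 'I_d0, 0 < s j) -> (forall j : 'I_d0, eps ^+ 2 / 2 <= rad j) ->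
  n%:R * eps ^+ 2 <= (54 ^- 2) ^+ 2 * (d0 * k)%:R -> eps <= 1 / 72 ->
  ((eps / 72)%:E <= minimax_excess_risk n d d0 s rad)%E.
Proof.
move=> s_gt0 le_rad n_eps eps_le.
have V0 : 0 < Vn by exact: lt_le_trans Vn_ge1.
have w0 a : 0 <= w a by exact: ltW.
have Vn0 : Vn != 0 by rewrite gt_eqF.
pose b (v : V) := eps ^+ 2 / Vn.
apply: (@design_lower R d A V n d0 s rad w x g phi main b eps) => //.
- move=> PX PXw.
  have xcube a : unit_cube (x a).
    move=> j; rewrite tnth_mktuple in_itv /=.
    by case: (z_trit a j) => ->; apply/andP; split; lra.
  split.
    apply: (admissible_discrete w0 sum_w xcube PXw) => c indep j.
    have := indep (inr (j, true)) (w_gt0 _); have := indep (inr (j, false)) (w_gt0 _).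
    rewrite (bigD1 j)//= [X in _ -> X = _ -> _](bigD1 j)//= !tnth_mktuple /= eqxx.
    rewrite (eq_bigr (fun i => c i * (1 / 2))) => [|i /negbTE ij]; last first.
      by rewrite tnth_mktuple /= ij mulr0 subr0.
    rewrite [X in _ -> _ + X = _ -> _](eq_bigr (fun i => c i * (1 / 2))) => [|i /negbTE ij]; last first.
      by rewrite tnth_mktuple /= ij mulr0 subr0.
    by rewrite /sgb !mulr1; set S := \sum_(i < d | _) _; lra.
  move=> th; apply: (@sparse_additive_discrete R d A w x PX w0 xcube PXw d0 s rad
    (kappa th) e (fun=> h) (kappaK th)).
  + by move=> j; exact: continuous_cos_poly.
  + move=> j; apply: periodic_sobolev_cos_poly => //; apply: le_trans (le_rad j).
    by rewrite big_ord1 powR1 mul1r expr_div_n sqr_sqrtr.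
  + move=> j; under eq_bigr do rewrite tnth_mktuple h_trit//.
    rewrite sum_atoms /= big1 => [|v _]; last by rewrite /sgb; lra.
    by rewrite big1 => [|v _]; rewrite ?mulr0 ?addr0// /sgb; lra.
- move=> th; apply: measurable_sum => j; apply: measurableT_comp; last exact: measurable_tnth.
  by apply: continuous_measurable_fun; exact: continuous_cos_poly.
- by move=> v; rewrite /b divr_ge0 ?sqr_ge0// ltW.
- by rewrite /b sum_cst card_V mulrC divfK// gt_eqF.
- move=> u; rewrite sum_main.
  have E v sg : (\sum_v' u v' * phi v' (inl (v, sg))) ^+ 2 = eps ^+ 2 * u v ^+ 2.
    rewrite (bigD1 v)//= eqxx big1 ?addr0.
      rewrite mul1r !exprMn sgb_sqr mulr1; ring.
    by move=> v' /negbTE ->; rewrite mul0r mulr0.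
  rewrite mulr_sumr; apply: ler_sum => v _; rewrite !E /b.
  have := delta_gt0; have := sqr_ge0 (eps * u v); rewrite exprMn.
  set p := eps ^+ 2 * u v ^+ 2 => p0 dl0.
  have -> : (1 - delta) / (2 * Vn) * (p + p) = (1 - delta) * (p / Vn).
    by move: (delta) (Vn) Vn0 => dl W W0; field.
  rewrite (_ : eps ^+ 2 / Vn * _ = p / Vn); last by rewrite /p; ring.
  rewrite ler_piMl ?divr_ge0 ?(ltW V0)//; lra.
- by move=> a /sum_phi2 ->; have := sqr_ge0 eps; lra.
- rewrite (eq_bigr (fun a => w a * eps ^+ 2)) => [|a /sum_phi2 -> //].
  rewrite sum_main sum_cst card_V.
  have := sqr_ge0 eps; set p := eps ^+ 2 => p0.
  have -> : (1 - delta) / (2 * Vn) * (Vn * (p + p)) = (1 - delta) * p.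
    by move: (delta) (Vn) Vn0 => dl W W0; field.
  by have := delta_le; nra.
- move=> v th _; rewrite sum_atoms.
  have E v' sg : (g th (x (inl (v', sg))) - g (flip v th) (x (inl (v', sg)))) ^+ 2 =
      (v == v')%:R * (4 * eps ^+ 2).
    rewrite !g_main// -sumrB (bigD1 v)//= flip_at sgbN big1 ?addr0.
      have [_|_] := eqVneq v v'; last by rewrite !mul0r !mulr0 subr0 expr0n.
      set p := eps; have h1 := @sgb_sqr R (th v); have h2 := @sgb_sqr R sg.
      rewrite (_ : (_ - _) ^+ 2 = sgb (th v) ^+ 2 * sgb sg ^+ 2 * (4 * p ^+ 2)); last by rewrite mul1r; ring.
      by rewrite h1 h2 !mul1r.
    by move=> u uv; rewrite flip_out// subrr.
  have E2 j sg : (g th (x (inr (j, sg))) - g (flip v th) (x (inr (j, sg)))) ^+ 2 <= 4 * eps ^+ 2.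
    have := g_side th j sg; have := g_side (flip v th) j sg.
    by rewrite !ler_norml => /andP[h1 h2] /andP[h3 h4]; nra.
  rewrite (eq_bigr (fun v' => (v == v')%:R * (8 * eps ^+ 2))) => [|v' _]; last by rewrite !E; ring.
  rewrite (bigD1 v)//= eqxx big1 ?addr0 => [|v' vv']; last by rewrite eq_sym (negbTE vv') mul0r.
  have side : \sum_j ((g th (x (inr (j, true))) - g (flip v th) (x (inr (j, true)))) ^+ 2 +
    (g th (x (inr (j, false))) - g (flip v th) (x (inr (j, false)))) ^+ 2) <= d%:R * (8 * eps ^+ 2).
    rewrite -[X in X%:R * _]card_ord -sum_cst; apply: ler_sum => j _.
    by have := E2 j true; have := E2 j false; lra.
  set S := \sum_j _ in side *.
  have side' : delta / (2 * d%:R) * S <= delta / (2 * d%:R) * (d%:R * (8 * eps ^+ 2)).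
    by rewrite ler_wpM2l// divr_ge0 ?mulr_ge0 ?(ltW delta_gt0) ?(ltW d_gt0).
  have dE : delta / (2 * d%:R) * (d%:R * (8 * eps ^+ 2)) = delta * 4 * eps ^+ 2.
    have D0 : d%:R != 0 :> R by rewrite gt_eqF.
    by move: (delta) (d%:R : R) D0 => dl D D0; field.
  rewrite dE in side'.
  apply: (@le_trans _ _ (n%:R * (6 * eps ^+ 2 / Vn))).
    rewrite ler_wpM2l//.
    have : (1 - delta) / (2 * Vn) * (1 * (8 * eps ^+ 2)) <= 4 * eps ^+ 2 / Vn.
      have -> : (1 - delta) / (2 * Vn) * (1 * (8 * eps ^+ 2)) =
          (1 - delta) * (4 * eps ^+ 2 / Vn).
        by move: (delta) (Vn) Vn0 => dl W W0; field.
      apply: ler_piMl; last by rewrite lerBlDr lerDl ltW.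
      by rewrite divr_ge0 ?mulr_ge0 ?sqr_ge0// ltW.
    have : delta * 4 * eps ^+ 2 = 2 * eps ^+ 2 / Vn by rewrite /delta; move: (Vn) Vn0 => W W0; field.
    move: side'; rewrite -/S; move: (_ * S) (_ / _ * (1 * _)) => p q; lra.
  have -> : n%:R * (6 * eps ^+ 2 / Vn) = 6 * (n%:R * eps ^+ 2 / Vn).
    by move: (Vn) Vn0 => W W0; field.
  have : n%:R * eps ^+ 2 / Vn <= (54 ^- 2) ^+ 2 by rewrite ler_pdivrMr.
  have : 0 <= (54 ^- 2 : R) ^+ 2 by exact: sqr_ge0.
  set p := n%:R * eps ^+ 2 / Vn; set q := (54 ^- 2) ^+ 2; move: p q => p q.
  lra.
Qed.

End selection_lower.

(** * The minimax bound *)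

Lemma ln2_ge_half (R : realType) : 1 / 2 <= ln 2 :> R.
Proof.
rewrite -[leLHS](expRK (1 / 2)) ler_ln ?posrE ?expR_gt0//.
have := expR_ge1Dx (- (1 / 2) : R); rewrite expRN => h.
have e0 := expR_gt0 (1 / 2 : R).
have : expR (1 / 2) * (expR (1 / 2))^-1 = 1 :> R by rewrite divff// gt_eqF.
by nra.
Qed.

Lemma ln2_le1 (R : realType) : ln 2 <= 1 :> R.
Proof. by rewrite -[leRHS]expRK ler_ln ?posrE ?expR_gt0//; have := expR_ge1Dx (1 : R); lra. Qed.

(** N is the integer part of n^(1 / (2 s + 1)), which is at least 1; the exponent
   in the rate is n^(1 / (2 s + 1)) / n. *)
Lemma exists_cutoff (R : realType) (s : R) (n : nat) : 0 < s -> (0 < n)%N ->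
  exists N : nat, [/\ (0 < N <= n)%N, N%:R * N%:R `^ (2 * s) <= n%:R :> R,
    n%:R `^ (- (2 * s / (2 * s + 1))) <= 2 * (N%:R / n%:R) &
    N%:R / n%:R <= n%:R `^ (- (2 * s / (2 * s + 1)))].
Proof.
move=> s0 n0; have n1 : 1 <= n%:R :> R by rewrite ler1n.
have n0R : 0 < n%:R :> R by lra.
pose x : R := n%:R `^ ((2 * s + 1)^-1).
have E : n%:R `^ (- (2 * s / (2 * s + 1))) = x / n%:R.
  have -> : - (2 * s / (2 * s + 1)) = (2 * s + 1)^-1 + (- 1).
    by field; rewrite gt_eqF//; lra.
  rewrite powRD; last by rewrite (gt_eqF n0R) implybT.
  by rewrite powR_inv1// ltW.
have x1 : 1 <= x.
  rewrite -[leLHS](powRr0 n%:R); apply: ler_powR => //.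
  by rewrite invr_ge0; lra.
have xn : x <= n%:R.
  rewrite -[leRHS](powRr1 (ltW n0R)); apply: ler_powR => //.
  by rewrite invf_le1; lra.
have /andP[N1 N2] := truncn_itv (le_trans ler01 x1).
exists (Num.truncn x); set N := Num.truncn x in N1 N2 *.
have N0 : (0 < N)%N.
  have : (1 : R) < N.+1%:R by exact: le_lt_trans N2.
  by rewrite ltr1n.
have N1R : 1 <= N%:R :> R by rewrite ler1n.
split.
- by rewrite N0 -(ler_nat R) (le_trans N1).
- have -> : N%:R * N%:R `^ (2 * s) = N%:R `^ (2 * s + 1) :> R.
    rewrite powRD; last by rewrite pnatr_eq0 -lt0n N0 implybT.
    by rewrite powRr1 ?ler0n// mulrC.
  have -> : n%:R = x `^ (2 * s + 1) :> R.
    by rewrite /x -powRrM mulVf ?powRr1 ?ler0n// gt_eqF//; lra.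
  by apply: ge0_ler_powR; rewrite ?nnegrE ?ler0n//; lra.
- rewrite E mulrA ler_pM2r ?invr_gt0//; move: N2; rewrite -natr1; lra.
- by rewrite E ler_pM2r ?invr_gt0.
Qed.

Theorem theorem3p3 (R : realType) (s rad : nat -> R) (rmin K : R)
    (s_gt : forall k, 1 / 2 < s k)
    (rmin_gt0 : 0 < rmin) (rad_ge : forall k, rmin <= rad k) :
  exists2 C : R, 0 < C &
    forall n d d0 : nat, (1 <= d0 <= d)%N ->
      let sel : R := d0%:R * ln (d%:R * expR 1 / d0%:R) in
      let est : R :=
        \sum_(j < d0) n%:R `^ (- (2 * s j / (2 * s j + 1))) in
      sel <= n%:R ->
      est <= K ->
      ((C * Num.sqrt (sel / n%:R + est))%:E
        <= minimax_excess_risk n d d0 s rad)%E.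
Proof.
(* The amplitude t of both experiments.  It keeps the perturbations
   indistinguishable (t <= 54^-2), inside the smallest Sobolev ball
   (t^2 <= rmin), and the logits small although the estimation term is only
   known to be at most K (t^2 K1 <= (1 / 72)^2). *)
pose K1 : R := `|K| + 1; have K1_ge1 : 1 <= K1 by rewrite lerDr.
pose r1 := Num.min 1 rmin.
have r1_gt0 : 0 < r1 by rewrite lt_min ltr01.
have r1_le1 : r1 <= 1 by rewrite ge_min lexx.
have r1_le : r1 <= rmin by rewrite ge_min lexx orbT.
pose t : R := 54 ^- 2 * r1 / K1.
have t_gt0 : 0 < t by rewrite divr_gt0 ?mulr_gt0// (lt_le_trans ltr01).
have tK : t * K1 = 54 ^- 2 * r1 by rewrite divfK// gt_eqF// (lt_le_trans ltr01).
have t_le : t <= 54 ^- 2 * r1 by rewrite -tK ler_peMr// ltW.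
have t_le' : t <= 54 ^- 2 by nra.
have t2_le : t ^+ 2 <= (54 ^- 2) ^+ 2 by nra.
have t2_rmin : t ^+ 2 <= rmin by nra.
have t2_K : t ^+ 2 * K1 <= (1 / 72) ^+ 2.
  by rewrite expr2 -mulrA tK; nra.
have s_gt0 j : 0 < s j by have := s_gt j; lra.
exists (t / 72 / 3); first by apply: divr_gt0 => //; exact: divr_gt0.
move=> n d d0 /andP[d0_gt0 d0d] sel est sel_n est_K.
have d0R : 0 < d0%:R :> R by rewrite ltr0n.
have dR : d0%:R <= d%:R :> R by rewrite ler_nat.
have dR0 : 0 < d%:R :> R by exact: lt_le_trans d0R dR.
have lnE : ln (d%:R * expR 1 / d0%:R) = 1 + ln (d%:R / d0%:R) :> R.
  by rewrite mulrAC lnM ?posrE ?expR_gt0 ?divr_gt0// expRK addrC.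
have ln_ge0 : 0 <= ln (d%:R / d0%:R) :> R.
  by rewrite ln_ge0// ler_pdivlMr// mul1r.
have selE : sel = d0%:R * (1 + ln (d%:R / d0%:R)) by rewrite /sel lnE.
have sel_d0 : d0%:R <= sel by rewrite selE ler_peMr ?lerDl// ltW.
have n_gt0 : (0 < n)%N by rewrite -(ltr0n R); lra.
have n0R : 0 < n%:R :> R by rewrite ltr0n.
have n_neq0 : n%:R != 0 :> R by rewrite gt_eqF.
(* Each experiment yields t / 72 times the root of some q; the factor 3 in the
   constant allows for a sum as large as 9 q. *)
suff [q le_q q_le] : exists2 q : R, sel / n%:R + est <= 6 * q &
    ((t / 72 * Num.sqrt q)%:E <= minimax_excess_risk n d d0 s rad)%E.
  apply: le_trans q_le; rewrite lee_fin -mulrA ler_pM2l; last exact: divr_gt0.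
  rewrite ler_pdivrMl// -[leRHS]ger0_norm ?mulr_ge0 ?sqrtr_ge0// -sqrtr_sqr.
  rewrite ler_wsqrtr// exprMn.
  have q0 : 0 <= q.
    have : 0 <= sel / n%:R by rewrite divr_ge0// ltW// (lt_le_trans d0R).
    have : 0 <= est by apply: sumr_ge0 => j _; exact: powR_ge0.
    by lra.
  by rewrite sqr_sqrtr//; lra.
have [N HN] := choice (fun j : 'I_d0 => exists_cutoff (s_gt0 j) n_gt0).
pose S : R := (\sum_j N j)%:R.
have S_est : S / n%:R <= est.
  rewrite /S natr_sum mulr_suml; apply: ler_sum => j _; by have [] := HN j.
have est_S : est <= 2 * (S / n%:R).
  by rewrite /S natr_sum mulr_suml mulr_sumr; apply: ler_sum => j _; have [] := HN j.
pose amp : R := t / Num.sqrt n%:R.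
have amp2 : amp ^+ 2 = t ^+ 2 / n%:R by rewrite expr_div_n sqr_sqrtr// ltW.
have est_lower : ((t / 72 * Num.sqrt (S / n%:R))%:E <= minimax_excess_risk n d d0 s rad)%E.
  have -> : t / 72 * Num.sqrt (S / n%:R) = amp * Num.sqrt S / 72.
    rewrite sqrtrM ?ler0n// sqrtrV ?ler0n// /amp.
    by move: (Num.sqrt S) (Num.sqrt n%:R) => a b; ring.
  apply: grid_lower => //.
  - by move=> j; have [/andP[]] := HN j.
  - by move=> j; have [/andP[]] := HN j.
  - by rewrite divr_gt0// sqrtr_gt0.
  - move=> j; apply: le_trans (rad_ge j); apply: le_trans t2_rmin.
    rewrite amp2 mulrA ler_pdivrMr// mulrC ler_wpM2l ?sqr_ge0//.
    by have [] := HN j.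
  - rewrite amp2 mulrCA divff// mulr1; nra.
  - rewrite amp2 mulrAC -mulrA; apply: le_trans t2_K; rewrite ler_wpM2l ?sqr_ge0//.
    apply: (le_trans S_est); apply: (le_trans est_K); rewrite /K1.
    by have := ler_norm K; lra.
(* Every component has at least one frequency, which pays for the part d0 of
   sel = d0 (1 + ln (d / d0)). *)
have est_d0 : d0%:R / n%:R <= S / n%:R.
  rewrite ler_wpM2r ?invr_ge0 ?ler0n// /S ler_nat -[leqLHS]card_ord -sum1_card.
  by apply: leq_sum => j _; have [/andP[]] := HN j.
have [d_small|d_large] := ltnP d (2 * d0).
  exists (S / n%:R) => //.
  have : sel / n%:R <= 2 * (d0%:R / n%:R).
    rewrite mulrA ler_wpM2r ?invr_ge0 ?ler0n// selE mulrC ler_wpM2r ?ler0n//.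
    have : ln (d%:R / d0%:R) <= ln 2 :> R.
      rewrite ler_ln ?posrE ?divr_gt0// ler_pdivrMr//.
      by rewrite -natrM ler_nat ltnW.
    by have := ln2_le1 R; lra.
  by lra.
(* With 2^k <= d / d0 < 2^k.+1 the logarithm is k up to constants, because
   1 / 2 <= ln 2 <= 1. *)
pose k := trunc_log 2 (d %/ d0).
have dd0 : (2 <= d %/ d0)%N by rewrite leq_divRL.
have k_gt0 : (0 < k)%N by rewrite trunc_log_gt0.
have d0k : (d0 * 2 ^ k <= d)%N.
  by rewrite mulnC -leq_divRL// trunc_logP// (leq_trans _ dd0).
have dk : (d < d0 * 2 ^ k.+1)%N.
  by rewrite mulnC -ltn_divLR// trunc_log_ltn.
have kR : 1 <= k%:R :> R by rewrite ler1n.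
have k_le : k%:R * ln 2 <= ln (d%:R / d0%:R) :> R.
  have p0 : 0 < (2 ^ k)%:R :> R by rewrite ltr0n expn_gt0.
  rewrite mulr_natl -lnXn// -natrX ler_ln ?posrE ?divr_gt0//.
  by rewrite ler_pdivlMr// mulrC -natrM ler_nat.
have le_k : ln (d%:R / d0%:R) <= k.+1%:R * ln 2 :> R.
  have p0 : 0 < (2 ^ k.+1)%:R :> R by rewrite ltr0n expn_gt0.
  rewrite [leRHS]mulr_natl -lnXn// -natrX ler_ln ?posrE ?divr_gt0//.
  by rewrite ler_pdivrMr// mulrC -natrM ler_nat ltnW.
pose q : R := d0%:R * k%:R / n%:R.
have q0 : 0 <= q by rewrite divr_ge0 ?mulr_ge0.
have q_le2 : q <= 2.
  rewrite ler_pdivrMr//; apply: le_trans (_ : 2 * sel <= _); last by rewrite ler_pM2l.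
  rewrite selE mulrCA ler_wpM2l ?ler0n//.
  have : k%:R * (1 / 2) <= k%:R * ln 2 :> R by rewrite ler_wpM2l ?ler0n// ln2_ge_half.
  by lra.
have sel_q : sel / n%:R <= 3 * q.
  rewrite /q mulrA ler_wpM2r ?invr_ge0 ?ler0n// selE mulrCA ler_wpM2l ?ler0n//.
  have : k.+1%:R * ln 2 <= k.+1%:R * 1 :> R by rewrite ler_wpM2l ?ler0n// ln2_le1.
  by move: le_k; rewrite -natr1; lra.
have sel_lower : ((t / 72 * Num.sqrt q)%:E <= minimax_excess_risk n d d0 s rad)%E.
  pose eps := t * Num.sqrt q.
  have q_gt0 : 0 < q by rewrite divr_gt0 ?mulr_gt0//; lra.
  have eps_gt0 : 0 < eps by rewrite mulr_gt0// sqrtr_gt0.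
  have eps2 : eps ^+ 2 = t ^+ 2 * q by rewrite exprMn sqr_sqrtr.
  have -> : t / 72 * Num.sqrt q = eps / 72 by rewrite /eps; ring.
  apply: (@selection_lower R n d d0 k) => //.
  - by move=> j; apply: le_trans (rad_ge j); rewrite eps2; nra.
  - rewrite eps2 mulrCA natrM (_ : n%:R * q = d0%:R * k%:R); last by rewrite mulrC divfK.
    by rewrite ler_wpM2r ?mulr_ge0.
  - have : eps ^+ 2 <= (1 / 72) ^+ 2 by rewrite eps2; nra.
    by move: (eps) eps_gt0 => u u_gt0; nra.
have [le1|/ltW le2] := leP (sel / n%:R) est.
  by exists (S / n%:R) => //; lra.
by exists q => //; lra.
Qed.
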